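(* Let $0<p<1$, $q=1-p$, and let $\Delta^{(p)}$ be the Laplacian on $I=[0,1]$ with parameter $p$ and Dirichlet boundary conditions. Let $\lambda_i$ be the $i$th Dirichlet eigenvalue of $-\Delta^{(p)}$ (in increasing order, $i\geq 1$) and let $f_i$ be the eigenfunction for $\lambda_i$. (a) For any Dirichlet eigenfunction $f$ of $-\Delta^{(p)}$, there is exactly one local extremum between two consecutive zeros of $f$. (b) $f_i$ has exactly $i-1$ zeros in the open interval $(0,1)$. (c) If $\lambda_i<\lambda_j$ and $x_k,x_{k+1}$ are consecutive zeros of $f_i$, then $f_j$ has at least one zero in $[x_k,x_{k+1}]$.
   Context: Let $F_i(x)=\frac x4+\frac i4$ for $i=0,1,2,3$. An $m$-cell is $A=F_{i_1}\circ\cdots\circ F_{i_m}(I)=[\frac{k}{4^m},\frac{k+1}{4^m}]$; let $i(A)=\#\{j: i_j\in\{0,3\}\}$. With $0<p<1$, $q=1-p$, $\mu$ is the Borel probability measure on $I$ with $\mu(A)=\frac{p^{i(A)}q^{m-i(A)}}{2^m}$ for every $m$-cell $A$, and the resistance of $A$ is $R(A)=\frac{q^{i(A)}p^{m-i(A)}}{2^m}$. The energy of a continuous function $f$ on $I$ is $\mathcal E(f)=\lim_{m\to\infty}\mathcal E_m(f)$, where $$\mathcal E_m(f)=\sum_{k=0}^{4^m-1}\frac{1}{R([\frac k{4^m},\frac{k+1}{4^m}])}\left(f\left(\tfrac k{4^m}\right)-f\left(\tfrac{k+1}{4^m}\right)\right)^2,$$ $\mathrm{dom}\,\mathcal E$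 is the set of continuous $f$ with $\mathcal E(f)<\infty$, and $\mathcal E(u,v)$ is the associated bilinear form. For $u\in\mathrm{dom}\,\mathcal E$ and $f$ continuous, $\Delta^{(p)}u=f$ means $\mathcal E(u,v)=-\int_I fv\,d\mu$ for all $v\in\mathrm{dom}\,\mathcal E$ with $v(0)=v(1)=0$. A Dirichlet eigenfunction with eigenvalue $\lambda$ is a nonzero $u$ with $u(0)=u(1)=0$ and $-\Delta^{(p)}u=\lambda u$. Zeros in (a) and (c) are zeros in $[0,1]$, the endpoints included. *)

(* Defs.v *)
From mathcomp Require Import all_boot all_order all_algebra.
From mathcomp Require Import all_classical all_reals all_analysis.
From mathcomp Require Import zify ring lra.

Set Implicit Arguments.
Unset Strict Implicit.
Unset Printing Implicit Defensive.
Import Order.TTheory GRing.Theory Num.Theory.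
Import numFieldNormedType.Exports.
Local Open Scope classical_set_scope.
Local Open Scope card_scope.
Local Open Scope ring_scope.

(** Functions on I = [0, 1] are represented by functions [R -> R] whose values
    outside of [0, 1] are irrelevant. *)

Section Cells.
Context {R : realType}.
Implicit Types (p x : R) (w : seq 'I_4) (f : R -> R).

Definition contr (i : 'I_4) x : R := x / 4 + i%:R / 4.

(** [contrw [:: i_1; ...; i_m]] is F_{i_1} o ... o F_{i_m}. *)
Definition contrw w : R -> R := foldr (fun i g => contr i \o g) id w.

Definition cell w : set R := contrw w @` `[0, 1].

Definition outer_count w : nat :=
  count (fun i : 'I_4 => (i == 0%N :> nat) || (i == 3%N :> nat)) w.

Definition cell_mass p w : R :=
  p ^+ outer_count w * (1 - p) ^+ (size w - outer_count w) / 2 ^+ size w.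

Definition cell_resistance p w : R :=
  (1 - p) ^+ outer_count w * p ^+ (size w - outer_count w) / 2 ^+ size w.

(** The m base-4 digits of k, most significant first: for k < 4 ^ m this is
    the address of the cell [k / 4 ^ m, (k + 1) / 4 ^ m], see [cell_address]. *)
Fixpoint address (m k : nat) : seq 'I_4 :=
  if m is m'.+1 then inord (k %/ 4 ^ m') :: address m' (k %% 4 ^ m') else [::].

Lemma size_address m k : size (address m k) = m.
Proof. by elim: m k => //= m IH k; rewrite IH. Qed.

Lemma contrw_address m k x : (k < 4 ^ m)%N ->
  contrw (address m k) x = (k%:R + x) / 4 ^+ m.
Proof.
elim: m k => [|m IH] k /= km.
  by move: km; rewrite expn0 ltnS leqn0 => /eqP ->; rewrite add0r expr0 divr1.
have m0 : (0 < 4 ^ m)%N by rewrite expn_gt0.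
rewrite IH ?ltn_mod// /contr inordK; last by rewrite ltn_divLR// -expnS.
rewrite [in RHS](divn_eq k (4 ^ m)) natrD natrM natrX exprS.
have : (4 : R) ^+ m != 0 by rewrite expf_neq0.
move: (4 ^+ m) => a a0; field; exact: a0.
Qed.

Lemma cell_address m k : (k < 4 ^ m)%N ->
  cell (address m k) = `[k%:R / 4 ^+ m, k.+1%:R / 4 ^+ m]%classic.
Proof.
move=> km; have m0 : 0 < (4 : R) ^+ m by rewrite exprn_gt0.
rewrite /cell; apply/seteqP; split => y /=.
  move=> [x]; rewrite /= !in_itv /= => /andP[x0 x1] <-; rewrite contrw_address//.
  by rewrite !ler_pM2r ?invr_gt0// -natr1 lerDl x0 lerD2l.
rewrite in_itv /= => /andP[ky yk]; exists (y * 4 ^+ m - k%:R).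
  by rewrite /= in_itv /= subr_ge0 -ler_pdivrMr// ky lerBlDr addrC natr1
    -ler_pdivlMr.
by rewrite contrw_address// addrC subrK mulfK// gt_eqF.
Qed.

End Cells.

Section Laplacian.
Context {R : realType}.
Implicit Types (p l x y : R) (u v f : R -> R).
Implicit Type mu : probability (measurableTypeR R) R.

(** The empty word gives mu [0, 1] = 1, so [mu] is carried by I. *)
Definition self_similar_measure p mu : Prop :=
  forall w : seq 'I_4, mu (cell w) = (cell_mass p w)%:E.

Definition energy_approx p (m : nat) f : R :=
  \sum_(0 <= k < 4 ^ m)
    (cell_resistance p (address m k))^-1
    * (f (k%:R / 4 ^+ m) - f (k.+1%:R / 4 ^+ m)) ^+ 2.

(** For 0 < p < 1 the sequence of approximations is nondecreasing, hence the
    limit always exists in the extended reals. *)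
Definition energy p f : \bar R := limn (fun m => (energy_approx p m f)%:E).

Definition dom_energy p f : Prop :=
  {within `[0, 1], continuous f} /\ (energy p f < +oo)%E.

(** Polarization; only meaningful for u and v in the domain. *)
Definition energy_form p u v : R :=
  (fine (energy p (u \+ v)) - fine (energy p (u \- v))) / 4.

Definition is_laplacian p mu u f : Prop :=
  [/\ dom_energy p u, {within `[0, 1], continuous f} &
      forall v, dom_energy p v -> v 0 = 0 -> v 1 = 0 ->
        energy_form p u v = - (\int[mu]_(x in `[0, 1]) (f x * v x))].

Definition dirichlet_eigenfunction p mu l u : Prop :=
  [/\ exists2 x, x \in `[0, 1] & u x != 0,
      u 0 = 0, u 1 = 0 & is_laplacian p mu u (fun x => - (l * u x))].

Definition dirichlet_eigenvalue p mu l : Prop :=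
  exists u, dirichlet_eigenfunction p mu l u.

(** [l] is the i-th eigenvalue, counting from i = 1: exactly i - 1 eigenvalues
    lie strictly below it.  Eigenvalues are counted without multiplicity (each
    Dirichlet eigenspace is one-dimensional). *)
Definition nth_dirichlet_eigenvalue p mu (i : nat) l : Prop :=
  [/\ (1 <= i)%N, dirichlet_eigenvalue p mu l &
      [set l' | dirichlet_eigenvalue p mu l' /\ l' < l] #= `I_(i - 1)%N].

Definition consecutive_zeros f x y : Prop :=
  [/\ [/\ 0 <= x, x < y & y <= 1], f x = 0, f y = 0 &
      forall z, x < z < y -> f z != 0].

Definition local_extremum f x : Prop :=
  (\forall y \near x, f y <= f x) \/ (\forall y \near x, f x <= f y).

End Laplacian.

(* Main.v *)
(** In the natural scale N (the resistance of [0, x]) the eigenvalue equation is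
    that of a vibrating string with mass mu.  Testing the weak formulation
    against the Green functions min(N x, N a) - N a * N x turns it into the
    Volterra equation

      u(x) = w N(x) - l * (integral over [0, x] of (N(x) - N(y)) u(y) dmu(y)),

    whose slope du/dN = w - l * mu(u 1_[0, x]) is continuous; conversely a
    solution with u(1) = 0 is an eigenfunction by Abel summation.  Where u > 0
    the slope strictly decreases, hence (a).  For two parameters l < l' the
    Wronskian is (l' - l) times the integral of the product, which yields
    Sturm's comparison theorem, hence (c), and the strict growth of the number
    of interior zeros from one eigenvalue to the next.  For (b) it remains to
    find n eigenvalues below any l whose solution phi_l has n interior zeros:
    zeros of phi_l are simple and depend continuously on l, so the smallest
    parameter beyond which there are n + 1 interior zeros has its last zero
    at 1 and n zeros inside. *)
Require Import Defs.
From mathcomp Require Import all_boot all_order all_algebra.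
From mathcomp Require Import all_classical all_reals all_analysis.
From mathcomp Require Import zify ring lra.
Import Order.TTheory GRing.Theory Num.Theory.
Import numFieldNormedType.Exports.
Local Open Scope classical_set_scope.
Local Open Scope card_scope.
Local Open Scope ring_scope.

Set Implicit Arguments.
Unset Strict Implicit.
Unset Printing Implicit Defensive.

(** * Cells, resistances and the natural scale *)

(** Neither the natural scale nor the mass offers a usable derivative in x, so the whole calculus
    runs on finite increments: the product rule for primitives comes from a defect with increments
    quadratic in the mass, and du/dN from an expansion whose remainder is a product of an increment
    of N and one of the mass. Both distribution functions enter only through [cell_cdf], that is
    through bounds on cells, together with the continuity that follows from them. All solutions for
    a given l are multiples of one function [picard_lim l], by a Gronwall estimate. Hence l is an
    eigenvalue exactly when [picard_lim l] vanishes at 1, and the zeros of an eigenfunction depend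
    on l alone. The exact count in (b) is assembled from two opposite lower bounds: eigenvalues
    below l produce interior zeros, and interior zeros produce eigenvalues below l. In this way
    neither discreteness of the spectrum nor finiteness of a zero set has to be established
    beforehand. *)

Section CellAddresses.
Context {R : realType} (p : R).

(** [address] peels off the leading digit, whereas subdividing a cell appends a trailing one; this
    reconciles the two orders. *)
Lemma address_rcons (m k j : nat) : (k < 4 ^ m)%N -> (j < 4)%N ->
  address m.+1 (4 * k + j) = rcons (address m k) (inord j).
Proof.
elim: m k => [|m IH] k km j4.
  by move: km; rewrite expn0 ltnS leqn0 => /eqP ->; rewrite /= muln0 divn1.
have a0 : (0 < 4 ^ m)%N by rewrite expn_gt0.
have E1 : ((4 * k + j) %/ 4 ^ m.+1 = k %/ 4 ^ m)%N.
  by rewrite expnS divnMA [(4 * k)%N]mulnC divnMDl// [(j %/ 4)%N]divn_small// addn0.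
have E2 : ((4 * k + j) %% 4 ^ m.+1 = 4 * (k %% 4 ^ m) + j)%N.
  rewrite {1}(divn_eq k (4 ^ m)) mulnDr -addnA mulnCA -expnS modnMDl modn_small//.
  by rewrite expnS; have := ltn_pmod k a0; lia.
have addressS n i :
  address n.+1 i = inord (i %/ 4 ^ n) :: address n (i %% 4 ^ n) by [].
by rewrite addressS E1 E2 IH ?ltn_pmod.
Qed.

(** Factor from the resistance of a cell to that of its j-th child. The outer children carry
    [1 - p], opposite to the mass. The four factors add up to 1, which is the series law behind the
    natural scale. *)
Definition split_ratio (j : nat) : R :=
  (if (j == 0%N) || (j == 3%N) then 1 - p else p) / 2.

Lemma cell_resistance_rcons (w : seq 'I_4) (i : 'I_4) :
  cell_resistance p (rcons w i) = cell_resistance p w * split_ratio i.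
Proof.
rewrite /cell_resistance /outer_count /split_ratio -cats1 count_cat size_cat /=.
rewrite addn0 addn1 exprS invfM.
have := count_size (fun i : 'I_4 => (i == 0%N :> nat) || (i == 3%N :> nat)) w.
set c := count _ _ => cw.
case: ifP => _ /=.
  by rewrite addn1 subSS exprSr; ring.
by rewrite addn0 subSn// exprSr; ring.
Qed.

Definition resistance (m k : nat) : R := cell_resistance p (address m k).

Lemma resistance_split (m k j : nat) : (k < 4 ^ m)%N -> (j < 4)%N ->
  resistance m.+1 (4 * k + j) = resistance m k * split_ratio j.
Proof.
by move=> km j4; rewrite /resistance address_rcons// cell_resistance_rcons inordK.
Qed.

Definition resistance_sum (m k : nat) : R := \sum_(0 <= j < k) resistance m j.

Lemma resistance_sumS (m k : nat) :
  resistance_sum m k.+1 = resistance_sum m k + resistance m k.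
Proof. by rewrite /resistance_sum big_nat_recr. Qed.

Lemma resistance_sum_refine (m k : nat) : (k <= 4 ^ m)%N ->
  resistance_sum m.+1 (4 * k) = resistance_sum m k.
Proof.
elim: k => [|k IH] km; first by rewrite /resistance_sum muln0 !big_nil.
have -> : resistance_sum m.+1 (4 * k.+1) = resistance_sum m.+1 (4 * k)
    + resistance m.+1 (4 * k + 0) + resistance m.+1 (4 * k + 1)
    + resistance m.+1 (4 * k + 2) + resistance m.+1 (4 * k + 3).
  have -> : (4 * k.+1 = (4 * k).+4)%N by lia.
  by rewrite !resistance_sumS addn0 addn1 addn2 addn3.
rewrite !resistance_split// /split_ratio /= resistance_sumS IH; last exact: ltnW.
lra.
Qed.

Lemma resistance_sum_refine_iter (m d k : nat) : (k <= 4 ^ m)%N ->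
  resistance_sum (m + d) (4 ^ d * k) = resistance_sum m k.
Proof.
move=> km; elim: d => [|d IH]; first by rewrite addn0 expn0 mul1n.
by rewrite addnS expnS -mulnA resistance_sum_refine// expnD mulnC leq_mul2r km orbT.
Qed.

Lemma resistance_sum_total (m : nat) : resistance_sum m (4 ^ m) = 1.
Proof.
rewrite -[RHS](_ : resistance_sum 0 1 = 1); last first.
  by rewrite resistance_sumS /resistance_sum big_nil /resistance
    /cell_resistance /= !expr0; lra.
by have := @resistance_sum_refine_iter 0 m 1 isT; rewrite add0n muln1.
Qed.

Lemma expf_half_bound (a b : R) (i j : nat) : 0 <= a <= 1 -> 0 <= b <= 1 ->
  0 <= a ^+ i * b ^+ j / 2 ^+ (i + j) <= (2 ^+ (i + j))^-1.
Proof.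
move=> /andP[a0 a1] /andP[b0 b1].
have h : 0 <= a ^+ i * b ^+ j <= 1.
  by rewrite mulr_ge0 ?exprn_ge0//= mulr_ile1 ?exprn_ge0 ?exprn_ile1.
have e0 : 0 <= ((2 : R) ^+ (i + j))^-1 by rewrite invr_ge0 exprn_ge0.
case/andP: h => h0 h1; rewrite mulr_ge0//=.
by rewrite -[leRHS]mul1r ler_wpM2r.
Qed.

Hypotheses (hp0 : 0 < p) (hp1 : p < 1).

Lemma resistance_gt0 (m k : nat) : 0 < resistance m k.
Proof. by rewrite divr_gt0 ?mulr_gt0 ?exprn_gt0 ?subr_gt0. Qed.

Lemma cell_mass_gt0 (w : seq 'I_4) : 0 < cell_mass p w.
Proof. by rewrite divr_gt0 ?mulr_gt0 ?exprn_gt0 ?subr_gt0. Qed.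

Lemma resistance_le (m k : nat) : resistance m k <= (2 ^+ m)^-1.
Proof.
rewrite /resistance /cell_resistance size_address.
have := count_size (fun i : 'I_4 => (i == 0%N :> nat) || (i == 3%N :> nat)) (address m k).
rewrite -/(outer_count _) size_address => cm.
have q01 : 0 <= 1 - p <= 1 by rewrite subr_ge0 gerBl !ltW.
have p01 : 0 <= p <= 1 by rewrite !ltW.
have /andP[_] := @expf_half_bound (1 - p) p (outer_count (address m k))
  (m - outer_count (address m k)) q01 p01.
by rewrite subnKC.
Qed.

Lemma cell_mass_le (w : seq 'I_4) : cell_mass p w <= (2 ^+ size w)^-1.
Proof.
have := count_size (fun i : 'I_4 => (i == 0%N :> nat) || (i == 3%N :> nat)) w.
rewrite -/(outer_count _) => cm.
have q01 : 0 <= 1 - p <= 1 by rewrite subr_ge0 gerBl !ltW.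
have p01 : 0 <= p <= 1 by rewrite !ltW.
have /andP[_] := @expf_half_bound p (1 - p) (outer_count w)
  (size w - outer_count w) p01 q01.
by rewrite subnKC.
Qed.

Lemma resistance_sum_mono (m i j : nat) : (i <= j)%N ->
  resistance_sum m i <= resistance_sum m j.
Proof.
move=> /subnKC <-; elim: (j - i)%N => [|d IH]; first by rewrite addn0.
by rewrite addnS resistance_sumS (le_trans IH)// lerDl ltW// resistance_gt0.
Qed.

(** Both sums are refined to level [m + n], where the order of the endpoints becomes that of the
    integer indices. *)
Lemma resistance_sum_le_dyadic (m n i j : nat) :
  (i <= 4 ^ m)%N -> (j <= 4 ^ n)%N -> i%:R / 4 ^+ m <= j%:R / 4 ^+ n :> R ->
  resistance_sum m i <= resistance_sum n j.
Proof.
move=> im jn; rewrite ler_pdivrMr ?exprn_gt0// mulrAC ler_pdivlMr ?exprn_gt0//.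
rewrite -!natrX -!natrM ler_nat => ij.
rewrite -(@resistance_sum_refine_iter m n)// -(@resistance_sum_refine_iter n m)//.
by rewrite addnC resistance_sum_mono// mulnC [(_ * j)%N]mulnC.
Qed.

(** The natural scale of the string: the resistance of [0, x], as a supremum
    over cells, so that no measure has to be constructed for it. *)
Definition scale_fun (x : R) : R :=
  sup [set y | exists m k : nat,
    [/\ (k <= 4 ^ m)%N, k%:R / 4 ^+ m <= x & y = resistance_sum m k]].

End CellAddresses.

(** * Modulus of continuity and strict growth of cell distribution functions *)

Section CellCdf.
Context {R : realType}.
Implicit Types (G : R -> R) (x y : R).

(** The only properties of [scale_fun p] and of [x |-> mu ]-oo, x]] that the
    theory of the string equation uses. *)
Definition cell_cdf G : Prop :=
  [/\ {homo G : x y / x <= y}, forall x, x <= 0 -> G x = 0,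
      forall x, 1 <= x -> G x = 1 &
      forall m k : nat, (k < 4 ^ m)%N ->
        0 < G (k.+1%:R / 4 ^+ m) - G (k%:R / 4 ^+ m) <= (2 ^+ m)^-1].

Lemma cell_cdf_itv G x : cell_cdf G -> 0 <= G x <= 1.
Proof.
case=> mono G0 G1 _; have [x0|/ltW x0] := leP x 0; first by rewrite G0// lexx ler01.
rewrite -{1}(G0 0 (lexx _)) mono//=.
have [x1|/ltW x1] := leP 1 x; first by rewrite G1.
by rewrite -{1}(G1 1 (lexx _)) mono.
Qed.

Lemma in_dyadic_cell (m : nat) x : 0 <= x < 1 ->
  exists2 k : nat, (k < 4 ^ m)%N & k%:R / 4 ^+ m <= x < k.+1%:R / 4 ^+ m.
Proof.
move=> /andP[x0 x1]; have e0 : 0 < (4 : R) ^+ m by rewrite exprn_gt0.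
have /truncn_itv/andP[h1 h2] : 0 <= x * 4 ^+ m by rewrite mulr_ge0// ltW.
exists (Num.truncn (x * 4 ^+ m)); last by rewrite ler_pdivrMr// ltr_pdivlMr// h1 h2.
rewrite -(ltr_nat R) (le_lt_trans h1)// natrX.
by rewrite -[ltRHS]mul1r ltr_pM2r.
Qed.

Lemma expr4V_cvg0 (e : R) : 0 < e -> exists m : nat, (4 ^+ m)^-1 < e.
Proof.
move=> e0; have /cvgrPdist_lt/(_ _ e0)[m _ /(_ m (leqnn m))] :
    (fun n : nat => (4^-1 : R) ^+ n) @ \oo --> 0.
  by apply: cvg_expr; rewrite ger0_norm; lra.
by rewrite sub0r normrN exprVn ger0_norm ?invr_ge0 ?exprn_ge0// => h; exists m.
Qed.

Lemma expr2V_cvg0 (e : R) : 0 < e -> exists m : nat, (2 ^+ m)^-1 < e.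
Proof.
move=> e0; have /cvgrPdist_lt/(_ _ e0)[m _ /(_ m (leqnn m))] :
    (fun n : nat => (2^-1 : R) ^+ n) @ \oo --> 0.
  by apply: cvg_expr; rewrite ger0_norm; lra.
by rewrite sub0r normrN exprVn ger0_norm ?invr_ge0 ?exprn_ge0// => h; exists m.
Qed.

(** An interval of length [4^-m] is covered by two consecutive m-cells, each contributing at most
    [2^-m]. *)
Lemma cell_cdf_modulus G (m : nat) x y : cell_cdf G -> x <= y ->
  y - x <= (4 ^+ m)^-1 -> G y - G x <= 2 * (2 ^+ m)^-1.
Proof.
move=> GG; case: (GG) => mono G0 G1 Gc.
have e0 : 0 < (4 : R) ^+ m by rewrite exprn_gt0.
have t0 : 0 < ((2 : R) ^+ m)^-1 by rewrite invr_gt0 exprn_gt0.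
wlog x0 : x / 0 <= x => [hw|xy yx].
  have [/hw//|xlt0 xy yx] := leP 0 x.
  have [y0|y0] := leP y 0; first by rewrite !G0// ?ltW//; lra.
  have := hw 0 (lexx _) (ltW y0); rewrite (G0 0 (lexx _)) (G0 _ (ltW xlt0)).
  by apply; lra.
have [x1|x1] := leP 1 x; first by rewrite !G1 ?(le_trans x1)//; lra.
have /in_dyadic_cell-/(_ m)[k km /andP[kx xk]] : 0 <= x < 1 by rewrite x0.
have yk : y <= k.+2%:R / 4 ^+ m.
  by move: xk; rewrite -[in k.+2%:R]natr1 mulrDl mul1r; lra.
have /andP[_ b1] := Gc m k km.
have Gx := mono _ _ kx.
(* The last cell has no right neighbour in [0, 1]; there its right end is 1, where [G] already takes
   its largest value. *)
move: (km); rewrite -ltnS ltnS leq_eqVlt => /orP[/eqP k4|k4].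
  have : G y <= G (k.+1%:R / 4 ^+ m).
    rewrite k4 natrX divff ?gt_eqF// (G1 1)//.
    by have /andP[] := cell_cdf_itv y GG.
  lra.
have /andP[_ b2] := Gc m k.+1 k4.
have := mono _ _ yk; lra.
Qed.

Lemma cell_cdf_unif G (e : R) : cell_cdf G -> 0 < e -> exists2 d : R, 0 < d &
  forall x y, x <= y -> y - x <= d -> G y - G x <= e.
Proof.
move=> GG e0; have [m hm] := @expr2V_cvg0 (e / 2) ltac:(lra).
exists (4 ^+ m)^-1; first by rewrite invr_gt0 exprn_gt0.
by move=> x y xy yx; have := cell_cdf_modulus GG xy yx; lra.
Qed.

Lemma cell_cdf_continuous G : cell_cdf G -> continuous G.
Proof.
move=> GG x; apply/cvgrPdist_le => e e0.
have [d d0 hd] := cell_cdf_unif GG e0; case: GG => mono _ _ _.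
near=> y.
have xy : `|x - y| <= d by near: y; apply: cvgr_dist_le.
have [le|/ltW le] := leP x y; have := mono _ _ le; have := hd _ _ le.
  rewrite distrC ger0_norm ?subr_ge0// in xy.
  by move=> /(_ xy) h1 h2; rewrite distrC ger0_norm ?subr_ge0.
rewrite ger0_norm ?subr_ge0// in xy.
by move=> /(_ xy) h1 h2; rewrite ger0_norm ?subr_ge0.
Unshelve. all: by end_near. Qed.

(** With cells shorter than half of [y - x], the cell just after the one containing [x] ends before
    [y]. *)
Lemma dyadic_between x y : 0 <= x -> x < y -> y <= 1 -> exists m k : nat,
  [/\ (k < 4 ^ m)%N, x < k%:R / 4 ^+ m & k.+1%:R / 4 ^+ m <= y].
Proof.
move=> x0 xy y1; have [m hm] := @expr4V_cvg0 ((y - x) / 2) ltac:(lra).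
have e0 : 0 < (4 : R) ^+ m by rewrite exprn_gt0.
have /in_dyadic_cell-/(_ m)[k km /andP[kx xk]] : 0 <= x < 1 by rewrite x0; lra.
have yk : k.+2%:R / 4 ^+ m <= y.
  by rewrite -[k.+2]addn2 natrD mulrDl; move: kx hm; move: (_^-1) => t; lra.
exists m, k.+1; split => //.
have := le_trans yk y1; rewrite ler_pdivrMr// mul1r -natrX ler_nat; lia.
Qed.

Lemma cell_cdf_lt G x y : cell_cdf G -> 0 <= x -> x < y -> y <= 1 -> G x < G y.
Proof.
move=> [mono _ _ Gc] x0 xy y1; have [m [k [km xk ky]]] := dyadic_between x0 xy y1.
have /andP[+ _] := Gc m k km.
have := mono _ _ (ltW xk); have := mono _ _ ky; lra.
Qed.

End CellCdf.

(** * The natural scale as a cell distribution function *)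

Section Scale.
Context {R : realType} (p : R) (hp0 : 0 < p) (hp1 : p < 1).

Lemma scale_dyadic (m k : nat) : (k <= 4 ^ m)%N ->
  scale_fun p (k%:R / 4 ^+ m) = resistance_sum p m k.
Proof.
move=> km; apply/eqP; rewrite eq_le; apply/andP; split.
  apply: sup_le_ub; first by exists (resistance_sum p m k), m, k.
  by move=> _ [n [j [jn jk ->]]]; apply: resistance_sum_le_dyadic.
apply: ub_le_sup; last by exists m, k.
exists (resistance_sum p m k) => _ [n [j [jn jk ->]]].
exact: resistance_sum_le_dyadic.
Qed.

(** To the left of 0 the defining set is empty, and [sup] of the empty set is 0 by convention, which
    is the value wanted. *)
Lemma scale_lt0 x : x < 0 -> scale_fun p x = 0.
Proof.
move=> x0; rewrite /scale_fun [X in sup X](_ : _ = set0) ?sup0// -subset0.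
move=> y [m [k [_ kx _]]]; have := le_lt_trans kx x0.
by rewrite ltNge divr_ge0// exprn_ge0.
Qed.

Lemma scale0 : scale_fun p 0 = 0.
Proof.
have := @scale_dyadic 0 0 isT.
by rewrite mul0r /resistance_sum big_nil.
Qed.

Lemma resistance_sum_itv (m k : nat) : (k <= 4 ^ m)%N -> 0 <= resistance_sum p m k <= 1.
Proof.
move=> km; apply/andP; split; last first.
  by rewrite -(resistance_sum_total p m) resistance_sum_mono.
by rewrite sumr_ge0// => j _; rewrite ltW// resistance_gt0.
Qed.

Lemma scale_mono : {homo scale_fun p : x y / x <= y}.
Proof.
move=> x y xy; have [x0|x0] := ltP x 0.
  rewrite scale_lt0//; have [y0|y0] := ltP y 0; first by rewrite scale_lt0.
  apply: ub_le_sup; first by exists 1 => _ [m [k [km _ ->]]]; have /andP[] := resistance_sum_itv km.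
  by exists 0%N, 0%N; split; rewrite ?mul0r// /resistance_sum big_nil.
apply: sup_le_ub; first by exists 0, 0%N, 0%N; split; rewrite ?mul0r// /resistance_sum big_nil.
move=> _ [m [k [km kx ->]]]; apply: ub_le_sup.
  by exists 1 => _ [n [j [jn _ ->]]]; have /andP[] := resistance_sum_itv jn.
by exists m, k; split => //; exact: le_trans xy.
Qed.

Lemma scale1 : scale_fun p 1 = 1.
Proof.
have := @scale_dyadic 0 1 isT; rewrite expr0 divr1 => ->.
by rewrite -[RHS](resistance_sum_total p 0).
Qed.

Lemma scale_cell (m k : nat) : (k < 4 ^ m)%N ->
  scale_fun p (k.+1%:R / 4 ^+ m) - scale_fun p (k%:R / 4 ^+ m) = resistance p m k.
Proof.
move=> km; rewrite !scale_dyadic//; last exact: ltnW.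
by rewrite resistance_sumS addrC addKr.
Qed.

Lemma scale_cell_cdf : cell_cdf (scale_fun p).
Proof.
split; first exact: scale_mono.
- by move=> x; rewrite le_eqVlt => /predU1P[->|/scale_lt0//]; exact: scale0.
- move=> x x1; apply/eqP; rewrite eq_le -{2}scale1 scale_mono// andbT.
  apply: sup_le_ub; first by exists 0, 0%N, 0%N; split;
    rewrite ?mul0r ?(le_trans ler01)// /resistance_sum big_nil.
  by move=> _ [m [k [km _ ->]]]; have /andP[] := resistance_sum_itv km.
- by move=> m k km; rewrite scale_cell// resistance_gt0// resistance_le.
Qed.

End Scale.

(** * Continuous functions and integration against [mu] *)

Section BoundedContinuous.
Context {R : realType}.
Implicit Types (f g u : R -> R) (a b x y e : R).

(** Both conditions are imposed on the whole line, so that integrability against [mu] holds on every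
    measurable set and no interval has to be carried along. Data known only on [0, 1] are extended
    by [clamp]. *)
Definition cb f : Prop := continuous f /\ exists C, forall x, `|f x| <= C.

Lemma cb_cst (c : R) : cb (fun=> c).
Proof. by split; [exact: cst_continuous|exists `|c|]. Qed.

Lemma cbD f g : cb f -> cb g -> cb (fun x => f x + g x).
Proof.
move=> [cf [C hC]] [cg [D hD]]; split; first by move=> x; exact: cvgD (cf x) (cg x).
by exists (C + D) => x; rewrite (le_trans (ler_normD _ _))// lerD.
Qed.

Lemma cbM f g : cb f -> cb g -> cb (fun x => f x * g x).
Proof.
move=> [cf [C hC]] [cg [D hD]]; split; first by move=> x; exact: cvgM (cf x) (cg x).
by exists (C * D) => x; rewrite normrM ler_pM.
Qed.

Lemma cbZ (c : R) f : cb f -> cb (fun x => c * f x).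
Proof. exact/cbM/cb_cst. Qed.

Lemma cbN f : cb f -> cb (fun x => - f x).
Proof. by move=> /(cbZ (-1)) h; under eq_fun do rewrite -mulN1r. Qed.

Lemma cbB f g : cb f -> cb g -> cb (fun x => f x - g x).
Proof. by move=> cf cg; exact: cbD (cbN cg). Qed.

Lemma cell_cdf_cb (G : R -> R) : cell_cdf G -> cb G.
Proof.
move=> GG; split; first exact: cell_cdf_continuous.
by exists 1 => x; have /andP[g0 g1] := cell_cdf_itv x GG; rewrite ger0_norm.
Qed.

Lemma cbX f (n : nat) : cb f -> cb (fun x => f x ^+ n).
Proof.
move=> cf; elim: n => [|n IH]; first exact: cb_cst.
by under eq_fun do rewrite exprS; exact: cbM.
Qed.

Lemma cb_sum (n : nat) (h : nat -> R -> R) : (forall i, cb (h i)) ->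
  cb (fun x => \sum_(0 <= i < n) h i x).
Proof.
move=> ch; elim: n => [|n IH].
  by under eq_fun do rewrite big_nil; exact: cb_cst.
by under eq_fun do rewrite big_nat_recr//=; exact: cbD.
Qed.

Lemma cb_norm f : cb f -> cb (fun x => `|f x|).
Proof.
move=> [cf [C hC]]; split; first by move=> x; exact: cvg_norm (cf x).
by exists C => x; rewrite normr_id.
Qed.

Lemma cb_ubound f : cb f -> exists2 C, 0 <= C & forall x, `|f x| <= C.
Proof. by move=> [_ [C hC]]; exists C => //; exact: le_trans (hC 0). Qed.

Definition clamp x : R := Num.min 1 (Num.max 0 x).

Lemma clamp_itv x : 0 <= clamp x <= 1.
Proof. by rewrite /clamp ge_min lexx/= andbT le_min ler01 le_max lexx. Qed.

Lemma clamp_id x : 0 <= x <= 1 -> clamp x = x.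
Proof. by move=> /andP[x0 x1]; rewrite /clamp max_r// min_r. Qed.

Lemma clamp_mono : {homo clamp : x y / x <= y}.
Proof. 
move=> x y xy; rewrite /clamp le_min ge_min lexx/= ge_min.
rewrite ge_max !le_max lexx/= xy !orbT//.
Qed.

Lemma cell_cdf_clamp G x : cell_cdf G -> G (clamp x) = G x.
Proof.
case=> _ G0 G1 _; rewrite /clamp.
have [x0|/ltW x0] := leP x 0; first by rewrite (min_r ler01) !G0.
by have [x1|x1] := leP 1 x; rewrite // !G1.
Qed.

Lemma clamp_continuous : continuous clamp.
Proof.
have lip (x y : R) : x <= y -> clamp y - clamp x <= y - x.
  move=> xy; rewrite /clamp /Num.min /Num.max; do 4 case: ifPn; rewrite -?leNgt; lra.
move=> x; apply/cvgrPdist_le => e e0; near=> y.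
have xy : `|x - y| <= e by near: y; apply: cvgr_dist_le.
apply: le_trans xy; have [le|/ltW le] := leP x y.
  have h1 := lip _ _ le; have h2 := clamp_mono le.
  by rewrite distrC [`|x - y|]distrC !ger0_norm ?subr_ge0.
have h1 := lip _ _ le; have h2 := clamp_mono le.
by rewrite !ger0_norm ?subr_ge0.
Unshelve. all: by end_near. Qed.

(** The weak formulation provides continuity only in the subspace topology of [0, 1]. Since [clamp]
    takes its values there, it is continuous into that subspace and the composite is continuous on
    the line. *)
Lemma cb_clamp u : {within `[0, 1], continuous u} -> cb (fun x => u (clamp x)).
Proof.
move=> cu; split.
  move=> x; apply: (cvg_comp clamp u (G := nbhs (clamp x : subspace `[0, 1]%classic)));
    last exact: cu.
  move=> P /= nP.
  have c01 : `[0, 1]%classic (clamp x) by rewrite /= in_itv /= clamp_itv.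
  have nP' : within `[0, 1]%classic (nbhs (clamp x)) P by rewrite nbhs_subspace_in.
  have near_x : nbhs x (fun y => `[0, 1]%classic (clamp y) -> P (clamp y)).
    exact: (clamp_continuous nP').
  rewrite /nbhs /=; apply: filterS near_x => y; apply.
  by rewrite /= in_itv /= clamp_itv.
have [a _ ha] := EVT_max ler01 cu; have [b _ hb] := EVT_min ler01 cu.
exists (Num.max `|u a| `|u b|) => x.
have c01 : clamp x \in `[0, 1] by rewrite in_itv /= clamp_itv.
have h1 := ha _ c01; have h2 := hb _ c01; rewrite le_max.
have [h|h] := leP 0 (u (clamp x)).
  by rewrite ger0_norm// (le_trans h1 (ler_norm _)).
rewrite ltr0_norm//; apply/orP; right.
by have := ler_norm (- u b); rewrite normrN; lra.
Qed.

Lemma uniform_continuity f (e : R) : cb f -> 0 < e -> exists2 d : R, 0 < d &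
  forall x y, 0 <= x <= 1 -> `|x - y| < d -> `|f x - f y| <= e.
Proof.
move=> [cf _] e0; have e20 : 0 < e / 2 by rewrite divr_gt0.
have /compact_near_coveringP cov := @segment_compact R 0 1.
have near_small : \forall d \near (0 : R)^'+, `[0, 1]%classic `<=`
    (fun x => forall y, `|x - y| < d -> `|f x - f y| <= e).
  apply: cov => x _; have /cvgrPdist_le/(_ _ e20)/nbhs_ballP[r /= r0 hr] := cf x.
  exists (ball x (r / 2), [set d | d < r / 2]) => /=.
    split; first by apply: nbhsx_ballx; rewrite divr_gt0.
    by apply: nbhs_right_lt; rewrite divr_gt0.
  move=> [x' d] /= [xx' dr] y x'y.
  have h1 : `|f x - f x'| <= e / 2.
    by apply: hr; move: xx'; rewrite /ball /=; lra.
  have h2 : `|f x - f y| <= e / 2.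
    apply: hr; move: xx'; rewrite /ball /= => xx'.
    by have := ler_normD (x - x') (x' - y); rewrite addrA subrK; lra.
  have := ler_normB (f x - f y) (f x - f x').
  rewrite (_ : f x - f y - (f x - f x') = f x' - f y); last by ring.
  lra.
near (0 : R)^'+ => d; exists d; first by near: d; exact: nbhs_right_gt.
move=> x y x01; have : `[0, 1]%classic `<=`
    (fun x => forall y, `|x - y| < d -> `|f x - f y| <= e) by near: d.
by apply; rewrite /= in_itv.
Unshelve. all: by end_near. Qed.

Lemma continuous_zero f x y : continuous f -> x <= y -> f x * f y <= 0 ->
  exists2 z, x <= z <= y & f z = 0.
Proof.
move=> cf xy fxy; have [|z] := @IVT _ f x y 0 xy (continuous_subspaceT cf).
  rewrite ge_min le_max; apply/andP; split; apply/orP.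
    have [fx|fx] := leP (f x) 0; [by left|right].
    by rewrite leNgt; apply/negP => fy; have := mulr_gt0 fx fy; rewrite ltNge fxy.
  have [fx|fx] := leP 0 (f x); [by left|right].
  rewrite leNgt; apply/negP => fy; suff : 0 < f x * f y by rewrite ltNge fxy.
  by rewrite nmulr_rgt0.
by rewrite in_itv => zxy fz; exists z.
Qed.

Lemma continuous_sign f a b : continuous f -> a < b ->
  (forall y, a < y < b -> f y != 0) ->
  (forall y, a < y < b -> 0 < f y) \/ (forall y, a < y < b -> f y < 0).
Proof.
move=> cf ab f0; pose m := (a + b) / 2; have mab : a < m < b by rewrite /m; lra.
have key y : a < y < b -> 0 < f m * f y.
  move=> yab; rewrite ltNge; apply/negP => h.
  have [z zab fz] : exists2 z, a < z < b & f z = 0.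
    have [my|/ltW ym] := leP m y.
      have [z /andP[z1 z2] fz] := continuous_zero cf my h.
      by exists z => //; lra.
    rewrite mulrC in h; have [z /andP[z1 z2] fz] := continuous_zero cf ym h.
    by exists z => //; lra.
  by have := f0 z zab; rewrite fz eqxx.
have [fm|fm|fm] := ltgtP 0 (f m).
- by left=> y /key; rewrite pmulr_rgt0.
- by right=> y /key; rewrite nmulr_rgt0.
- by have := f0 m mab; rewrite -fm eqxx.
Qed.

Lemma continuous_ge0_itvcc f a b : continuous f -> a < b ->
  (forall y, a < y < b -> 0 < f y) -> forall y, a <= y <= b -> 0 <= f y.
Proof.
move=> cf ab f0 y /andP[ay yb]; rewrite leNgt; apply/negP => fy.
pose m := (a + b) / 2; have mab : a < m < b by rewrite /m; lra.
have fm := f0 m mab; have fym : f y * f m <= 0 by rewrite nmulr_rle0// ltW.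
have [z zab fz] : exists2 z, y <= z <= m \/ m <= z <= y & f z = 0.
  have [le|/ltW le] := leP y m.
    by have [z ? ?] := continuous_zero cf le fym; exists z => //; left.
  rewrite mulrC in fym.
  by have [z ? ?] := continuous_zero cf le fym; exists z => //; right.
have zy : z != y by apply/eqP => zy; rewrite -zy fz ltxx in fy.
suff /f0 : a < z < b by rewrite fz ltxx.
move: zy; rewrite neq_lt => /orP[] zy; case: zab => /andP[? ?]; lra.
Qed.

Lemma exp_series_le (L : R) (n : nat) : 0 <= L -> series (exp_coeff L) n <= expR L.
Proof.
move=> L0; apply: nondecreasing_cvgn_le; last exact: is_cvg_series_exp_coeff.
by apply/nondecreasing_seqP => k; rewrite /series /= big_nat_recr//= lerDl exp_coeff_ge0.
Qed.

Lemma dominated_continuous (G h : R -> R) (C : R) : cell_cdf G ->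
  (forall a b, a <= b -> `|h b - h a| <= C * (G b - G a)) -> continuous h.
Proof.
move=> GG hC; have C0 : 0 <= C.
  have := hC 0 1 ler01; case: (GG) => _ G0 G1 _.
  rewrite (G0 0 (lexx _)) (G1 1 (lexx _)) subr0 mulr1.
  exact: le_trans.
move=> x; apply/cvgrPdist_le => e e0.
(* The denominator is [C + 1] because [C] may be 0. *)
have [d d0 hd] := cell_cdf_unif GG (divr_gt0 e0 (ltr_wpDl C0 ltr01)).
have small a b : a <= b -> b - a <= d -> `|h b - h a| <= e.
  move=> ab bad; apply: (le_trans (hC _ _ ab)).
  apply: (le_trans (ler_wpM2l C0 (hd _ _ ab bad))).
  by rewrite mulrCA ger_pMr// ler_pdivrMr ?mul1r ?lerDl//; lra.
near=> y.
have xy : `|x - y| <= d by near: y; apply: cvgr_dist_le.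
have [le|/ltW le] := leP x y.
  by rewrite distrC small//; rewrite distrC ger0_norm ?subr_ge0 in xy.
by rewrite small//; rewrite ger0_norm ?subr_ge0 in xy.
Unshelve. all: by end_near. Qed.

End BoundedContinuous.

(** * Primitives with respect to the measure *)

Section Primitive.
Context {R : realType} (mu : probability (measurableTypeR R) R).
Implicit Types (f g : R -> R) (a b x y : R).

(** The half-line, rather than [0, x], makes every increment an integral over []a, b]] and gives a
    meaning to all real [x]. *)
Definition primitive g x : R := \int[mu]_(y in `]-oo, x]) g y.

Local Notation F := primitive.

Lemma cb_integrable g (A : set (measurableTypeR R)) : measurable A -> cb g ->
  mu.-integrable A (EFin \o g).
Proof.
move=> mA [cg [C hC]]; apply: measurable_bounded_integrable => //.
- by rewrite (le_lt_trans (probability_le1 _ _))// ltry.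
- apply: measurable_funS (measurable_realfun.continuous_measurable_fun cg) => //.
- by exists C; split; [exact: num_real|move=> D CD x _; exact: le_trans (ltW CD)].
Qed.

Lemma primitiveZ (c : R) f x : cb f -> F (fun y => c * f y) x = c * F f x.
Proof. by move=> cf; rewrite /F RintegralZl//; exact: cb_integrable. Qed.

Lemma primitiveD f g x : cb f -> cb g ->
  F (fun y => f y + g y) x = F f x + F g x.
Proof. by move=> cf cg; rewrite /F RintegralD//; exact: cb_integrable. Qed.

Lemma primitiveB f g x : cb f -> cb g ->
  F (fun y => f y - g y) x = F f x - F g x.
Proof. by move=> cf cg; rewrite /F RintegralB//; exact: cb_integrable. Qed.

Lemma primitive_incr g a b : cb g -> a <= b ->
  F g b - F g a = \int[mu]_(y in `]a, b]) g y.
Proof.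
move=> cg ab; rewrite /F.
have -> : `]-oo, b]%classic = `]-oo, a]%classic `|` `]a, b]%classic.
  apply/seteqP; split => y /=; rewrite !in_itv /=.
    by move=> yb; have [ya|ya] := leP y a; [left|right].
  by case=> [/le_trans|/andP[]//]; exact.
rewrite Rintegral_setU//.
- by rewrite addrC addKr.
- by apply: cb_integrable => //; exact: measurableU.
- apply/disj_setPS => y [] /=; rewrite !in_itv /= => ya /andP[ay _].
  by have := le_lt_trans ya ay; rewrite ltxx.
Qed.

Hypothesis mu01 : mu `[0, 1]%classic = 1%E.

Lemma mass_outside :
  mu (~` `[0, 1]%classic : set (measurableTypeR R)) = 0%E.
Proof. by rewrite probability_setC// mu01 subee. Qed.

(** The complement of [0, 1] is negligible, so estimates valid only on [0, 1] control integrals over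
    any measurable set. *)
Lemma Rintegral_inside g (A : set (measurableTypeR R)) : measurable A -> cb g ->
  \int[mu]_(y in A) g y = \int[mu]_(y in A `&` `[0, 1]) g y.
Proof.
move=> mA cg; rewrite /Rintegral.
rewrite (@negligible_integral _ _ _ _ _ (~` `[0, 1]%classic : set (measurableTypeR R)))//.
- by congr (fine (integral _ _ _)); rewrite setDE setCK.
- exact: measurableC.
- exact: cb_integrable.
- exact: mass_outside.
Qed.

Lemma primitive_le f g a b : cb f -> cb g -> a <= b ->
  (forall y, a < y <= b -> 0 <= y <= 1 -> f y <= g y) ->
  F f b - F f a <= F g b - F g a.
Proof.
move=> cf cg ab fg; rewrite !primitive_incr//.
have mab : measurable (`]a, b]%classic : set (measurableTypeR R)) by [].
rewrite (Rintegral_inside mab cf) (Rintegral_inside mab cg).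
apply: le_Rintegral.
- exact: measurableI.
- by apply: cb_integrable => //; exact: measurableI.
- by apply: cb_integrable => //; exact: measurableI.
- by move=> y [] /=; rewrite !in_itv /=; exact: fg.
Qed.

Definition mass x : R := fine (mu `]-oo, x]%classic).

Lemma primitive_cst (c : R) x : F (fun=> c) x = c * mass x.
Proof. by rewrite /F Rintegral_cst. Qed.

Lemma primitive_lb (c : R) g a b : cb g -> a <= b ->
  (forall y, a < y <= b -> 0 <= y <= 1 -> c <= g y) ->
  c * (mass b - mass a) <= F g b - F g a.
Proof.
move=> cg ab cgy; have := @primitive_le (fun=> c) g a b (cb_cst c) cg ab cgy.
by rewrite !primitive_cst mulrBr.
Qed.

Lemma primitive_ub (c : R) g a b : cb g -> a <= b ->
  (forall y, a < y <= b -> 0 <= y <= 1 -> g y <= c) ->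
  F g b - F g a <= c * (mass b - mass a).
Proof.
move=> cg ab cgy; have := @primitive_le g (fun=> c) a b cg (cb_cst c) ab cgy.
by rewrite !primitive_cst mulrBr.
Qed.

Lemma primitive_bound (c : R) g a b : cb g -> a <= b ->
  (forall y, a < y <= b -> 0 <= y <= 1 -> `|g y| <= c) ->
  `|F g b - F g a| <= c * (mass b - mass a).
Proof.
move=> cg ab cgy; rewrite ler_norml -mulNr primitive_lb ?primitive_ub//= => y aby y01;
  by have := cgy y aby y01; rewrite ler_norml => /andP[].
Qed.

Lemma primitive_incr_eq f g a b : cb f -> cb g -> a <= b ->
  (forall y, a < y <= b -> 0 <= y <= 1 -> f y = g y) ->
  F f b - F f a = F g b - F g a.
Proof.
move=> cf cg ab fg; apply/eqP; rewrite eq_le !primitive_le// => y h1 h2;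
  by rewrite fg.
Qed.

Lemma mass_mono : {homo mass : x y / x <= y}.
Proof.
move=> x y xy; have := @primitive_lb 0 (fun=> 1) x y (cb_cst 1) xy (fun _ _ _ => ler01).
by rewrite mul0r !primitive_cst !mul1r subr_ge0.
Qed.

Lemma primitive1 g : cb g -> F g 1 = \int[mu]_(y in `[0, 1]) g y.
Proof.
move=> cg; rewrite /F Rintegral_inside//; congr Rintegral.
apply/seteqP; split => y /=; rewrite !in_itv /= => h; first by case: h.
by split => //; case/andP: h.
Qed.

End Primitive.

(** * Absence of atoms and the distribution function of the measure *)

Section SelfSimilarMass.
Context {R : realType} (p : R) (hp0 : 0 < p) (hp1 : p < 1).
Context (mu : probability (measurableTypeR R) R) (hmu : self_similar_measure p mu).
Implicit Types (g : R -> R) (x : R).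

Lemma self_similar_carrier : mu `[0, 1]%classic = 1%E.
Proof.
have := hmu [::]; rewrite /cell_mass /= !expr0 !mulr1 divr1 => <-; congr (mu _).
by apply/seteqP; split => [x x01|_ [x x01 <-]]//; exists x.
Qed.

Lemma self_similar_dyadic_cell (m k : nat) : (k < 4 ^ m)%N ->
  mu `[k%:R / 4 ^+ m, k.+1%:R / 4 ^+ m]%classic = (cell_mass p (address m k))%:E.
Proof. by move=> km; rewrite -cell_address. Qed.

(** A point of [0, 1] lies, for every [m], in a cell of mass at most [2^-m]. Absence of atoms lets
    the closed cells, whose mass is prescribed, be traded for half-open ones. *)
Lemma self_similar_set1 x : mu [set x] = 0%E.
Proof.
have mx : measurable ([set x] : set (measurableTypeR R)) by exact: measurable_set1.
have [x01|x01] := boolP (0 <= x <= 1); last first.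
  apply/eqP; rewrite eq_le measure_ge0 andbT.
  rewrite -(_ : mu (~` `[0, 1]%classic) = 0%E); last first.
    by apply: mass_outside; exact: self_similar_carrier.
  apply: le_measure; rewrite ?inE//; first exact: measurableC.
  by move=> y ->; rewrite /= in_itv /=; apply/negP.
have small (m : nat) : (mu [set x] <= ((2 ^+ m)^-1)%:E)%E.
  have [k km xk] : exists2 k : nat, (k < 4 ^ m)%N &
      x \in `[k%:R / 4 ^+ m, k.+1%:R / 4 ^+ m].
    case/andP: x01 => x0; rewrite le_eqVlt => /predU1P[->|x1].
      (* The point 1 belongs to no half-open cell of [0, 1), so the last closed cell is named
         explicitly. *)
      exists (4 ^ m).-1; first by rewrite prednK// expn_gt0.
      rewrite in_itv /= prednK ?expn_gt0// natrX divff ?expf_neq0// lexx andbT.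
      rewrite ler_pdivrMr ?exprn_gt0// mul1r -natrX ler_nat; exact: leq_pred.
    have /in_dyadic_cell-/(_ m)[k km /andP[kx xk]] : 0 <= x < 1 by rewrite x0.
    by exists k => //; rewrite in_itv /= kx ltW.
  apply: (@le_trans _ _ (cell_mass p (address m k))%:E); last first.
    by rewrite lee_fin -{2}(size_address m k) cell_mass_le.
  rewrite -self_similar_dyadic_cell//; apply: le_measure; rewrite ?inE//.
  by move=> y ->.
apply/eqP; rewrite eq_le measure_ge0 andbT.
apply/lee_addgt0Pr => e e0; rewrite add0e.
have [m /ltW hm] := expr2V_cvg0 e0.
by rewrite (le_trans (small m))// lee_fin.
Qed.

Lemma mass_incr a b : a <= b ->
  mass mu b - mass mu a = fine (mu `]a, b]%classic).
Proof.
move=> ab; have := primitive_incr mu (cb_cst 1) ab.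
by rewrite !primitive_cst Rintegral_cst// !mul1r.
Qed.

Lemma mass_cell_cdf : cell_cdf (mass mu).
Proof.
have mu0 x : x <= 0 -> mass mu x = 0.
  move=> x0; rewrite /mass (_ : mu _ = 0%E)//.
  apply/eqP; rewrite eq_le measure_ge0 andbT.
  apply: (@le_trans _ _ (mu (~` `[0, 1]%classic `|` [set 0]))).
    apply: le_measure; rewrite ?inE//.
      by apply: measurableU; [exact: measurableC|exact: measurable_set1].
    move=> y /=; rewrite !in_itv /= => yx.
    have [->|y0] := eqVneq y 0; [by right|left].
    by move=> /andP[y1 _]; case/eqP: y0; apply/eqP; rewrite eq_le y1 (le_trans yx).
  apply: (le_trans (measureU2 _ _ _)).
  - exact: measurableC.
  - exact: measurable_set1.
  rewrite [X in (_ + X)%E](_ : _ = 0%E); last exact: self_similar_set1.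
  rewrite [X in (X + _)%E](_ : _ = 0%E) ?adde0//.
  by apply: mass_outside; exact: self_similar_carrier.
split => //.
- exact: mass_mono self_similar_carrier.
- move=> x x1; rewrite /mass (_ : mu _ = 1%E)//.
  apply/eqP; rewrite eq_le probability_le1//= -self_similar_carrier.
  apply: le_measure; rewrite ?inE// => y /=; rewrite !in_itv /= => /andP[_ y1].
  exact: le_trans x1.
- move=> m k km; rewrite mass_incr; last first.
    by rewrite ler_pM2r ?invr_gt0 ?exprn_gt0// ler_nat.
  suff -> : mu `]k%:R / 4 ^+ m, k.+1%:R / 4 ^+ m]%classic =
      (cell_mass p (address m k))%:E.
    by rewrite /= cell_mass_gt0//= -{2}(size_address m k) cell_mass_le.
  (* The closed cell is the half-open one together with its left endpoint, which is null. *)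
  rewrite -self_similar_dyadic_cell// -[LHS]add0e -(self_similar_set1 (k%:R / 4 ^+ m)).
  rewrite -measureU//.
  - by rewrite setU1itv//= bnd_simp ler_pM2r ?invr_gt0 ?exprn_gt0// ler_nat.
  - by apply/seteqP; split => y //= [->]; rewrite in_itv /= ltxx.
Qed.

End SelfSimilarMass.

(* [a1], [a2], [a3] (resp. [b1], [b2], [b3]) are the values right (resp. left)
   of a zero of slope [s] of three nearby functions, the first of which
   vanishes there. *)
Lemma perturbed_sign_change (R : realFieldType) (c k s n1 n2 n3 a1 a2 a3 b1 b2 b3 : R) :
  0 < c -> 0 < k -> k <= n2 - n1 -> k <= n3 - n2 ->
  `|a1 - a3| <= c * k / 8 -> `|a2 - a3| <= c * k / 8 ->
  `|b1 - b3| <= c * k / 8 -> `|b2 - b3| <= c * k / 8 ->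
  `|b1 - s * (n1 - n2)| <= `|s| / 2 * - (n1 - n2) ->
  `|a1 - s * (n3 - n2)| <= `|s| / 2 * (n3 - n2) -> c <= `|s| -> b2 * a2 <= 0.
Proof.
move=> c0 k0 n12 n23; have ck := mulr_gt0 c0 k0; rewrite !ler_norml.
have [sp|sn] := ler0P s => /andP[i1 i2] /andP[i3 i4] /andP[i5 i6] /andP[i7 i8]
    /andP[i9 i10] /andP[i11 i12] cs.
  have g1 : c * k <= - s * (n2 - n1) by rewrite ler_pM// ltW.
  have g2 : c * k <= - s * (n3 - n2) by rewrite ler_pM// ltW.
  have a20 : a2 <= 0 by lra.
  have b20 : 0 <= b2 by lra.
  by rewrite mulr_ge0_le0.
have g1 : c * k <= s * (n2 - n1) by rewrite ler_pM// ltW.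
have g2 : c * k <= s * (n3 - n2) by rewrite ler_pM// ltW.
have a20 : 0 <= a2 by lra.
have b20 : b2 <= 0 by lra.
by rewrite mulr_le0_ge0.
Qed.

(** * The string equation and Sturm theory *)

Section StringEquation.
Context {R : realType} (N : R -> R) (mu : probability (measurableTypeR R) R).
Hypotheses (hN : cell_cdf N) (hM : cell_cdf (mass mu))
  (mu01 : mu `[0, 1]%classic = 1%E).
Implicit Types (f g u v : R -> R) (a b x y l w : R).

Local Notation F := (primitive mu).
Local Notation M := (mass mu).

Let N_mono : {homo N : x y / x <= y}. Proof. by case: hN. Qed.
Let M_mono : {homo M : x y / x <= y}. Proof. by case: hM. Qed.
Let N_itv x : 0 <= N x <= 1. Proof. exact: cell_cdf_itv. Qed.
Let M_itv x : 0 <= M x <= 1. Proof. exact: cell_cdf_itv. Qed.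
Let N0 : N 0 = 0. Proof. by case: hN => _ -> //. Qed.
Let M0 : M 0 = 0. Proof. by case: hM => _ -> //. Qed.
Let M1 : M 1 = 1. Proof. by case: hM => _ _ -> //. Qed.
Let cb_N : cb N. Proof. exact: cell_cdf_cb. Qed.
Let cb_M : cb M. Proof. exact: cell_cdf_cb. Qed.

Lemma primitive_le0 g x : cb g -> x <= 0 -> F g x = 0.
Proof.
move=> cg x0; have [C hC] := cg.2; apply/eqP; rewrite -normr_eq0 eq_le normr_ge0 andbT.
have mx : measurable (`]-oo, x]%classic : set (measurableTypeR R)) by [].
rewrite (le_trans (le_normr_Rintegral mx (cb_integrable mu mx cg)))//.
have cn : cb (fun y => `|g y|).
  by split; [move=> y; exact: cvg_norm (cg.1 y)|exists C => y; rewrite normr_id].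
rewrite (le_trans (le_Rintegral mx (cb_integrable mu mx cn)
  (cb_integrable mu mx (cb_cst C)) (fun y _ => hC y)))//.
rewrite Rintegral_cst// -/(mass mu x); case: hM => _ -> //; by rewrite mulr0.
Qed.

Lemma primitive0 g : cb g -> F g 0 = 0.
Proof. by move=> cg; rewrite primitive_le0. Qed.

Lemma primitive_eq f g x : cb f -> cb g -> 0 <= x ->
  (forall y, 0 <= y <= 1 -> y <= x -> f y = g y) -> F f x = F g x.
Proof.
move=> cf cg x0 fg; have := @primitive_incr_eq _ _ mu01 f g 0 x cf cg x0.
by rewrite !primitive0// !subr0; apply=> y /andP[_ yx] y01; exact: fg.
Qed.

Lemma primitive_ler f g x : cb f -> cb g -> 0 <= x ->
  (forall y, 0 <= y <= 1 -> y <= x -> f y <= g y) -> F f x <= F g x.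
Proof.
move=> cf cg x0 fg; have := @primitive_le _ _ mu01 f g 0 x cf cg x0.
by rewrite !primitive0// !subr0; apply=> y /andP[_ yx] y01; exact: fg.
Qed.

Lemma primitive_norm (C : R) g x : cb g -> 0 <= C ->
  (forall y, 0 <= y <= 1 -> `|g y| <= C) -> `|F g x| <= C.
Proof.
move=> cg C0 gC; have [x0|/ltW x0] := leP x 0; first by rewrite primitive_le0// normr0.
have := @primitive_bound _ _ mu01 C g 0 x cg x0 (fun y _ => gC y).
rewrite primitive0// M0 !subr0 => /le_trans; apply.
by have /andP[_ Mx] := M_itv x; rewrite ler_piMr.
Qed.

Lemma cb_primitive g : cb g -> cb (F g).
Proof.
move=> cg; have [C hC] := cg.2; have C0 : 0 <= C := le_trans (normr_ge0 _) (hC 0).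
split; last by exists C => x; exact: primitive_norm.
apply: (@dominated_continuous _ M _ C) => // a b ab.
exact: primitive_bound.
Qed.

(** By continuity [g] stays above [g c / 2] on a short interval to the right of [c], and that
    interval has positive mass. *)
Lemma primitive_pos g a b c : cb g -> 0 <= a -> a < c -> c < b -> b <= 1 ->
  (forall y, a <= y <= b -> 0 <= g y) -> 0 < g c -> F g a < F g b.
Proof.
move=> cg a0 ac cb' b1 g0 gc.
have [d d0 hd] : exists2 d, 0 < d & forall y, `|c - y| < d -> g c / 2 <= g y.
  have /cvgrPdist_le/(_ (g c / 2) (divr_gt0 gc (ltr0Sn _ 1))) := cg.1 c.
  move=> /nbhs_ballP[d /= d0 hd]; exists d => // y cy.
  have : `|g c - g y| <= g c / 2 by exact: hd.
  by rewrite ler_norml => /andP[_]; lra.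
pose c' := Num.min b (c + d / 2).
have cc' : c < c' by rewrite lt_min cb' /=; lra.
have c'b : c' <= b by rewrite ge_min lexx.
have c'd : c' <= c + d / 2 by rewrite ge_min lexx orbT.
have h1 := @primitive_lb _ _ mu01 0 g a c cg (ltW ac).
have h2 := @primitive_lb _ _ mu01 (g c / 2) g c c' cg (ltW cc').
have h3 := @primitive_lb _ _ mu01 0 g c' b cg c'b.
have {}h1 : 0 * (M c - M a) <= F g c - F g a.
  by apply: h1 => y /andP[? ?] _; apply: g0; lra.
have {}h3 : 0 * (M b - M c') <= F g b - F g c'.
  by apply: h3 => y /andP[? ?] _; apply: g0; lra.
have {}h2 : g c / 2 * (M c' - M c) <= F g c' - F g c.
  by apply: h2 => y /andP[? ?] _; apply: hd; rewrite distrC ger0_norm; lra.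
have Mc : M c < M c' by apply: (cell_cdf_lt hM) => //; lra.
have : 0 < g c / 2 * (M c' - M c) by rewrite mulr_gt0 ?subr_gt0//; lra.
lra.
Qed.

(* Replaces the derivative-zero criterion: nothing here is differentiable. *)
Lemma quadratic_increments_cst (D : R -> R) (C x : R) : 0 <= x <= 1 ->
  (forall a b, 0 <= a -> a <= b -> b <= 1 ->
    `|D b - D a| <= C * (M b - M a) ^+ 2) -> D x = D 0.
Proof.
move=> /andP[x0 x1] hD; have C0 : 0 <= C.
  have := hD 0 1 (lexx _) ler01 (lexx _); rewrite M0 M1 subr0 expr1n mulr1.
  exact: le_trans.
have small e : 0 < e -> `|D x - D 0| <= C * e.
  move=> e0; have [d d0 hd] := cell_cdf_unif hM e0.
  (* [0, x] is cut into [n] pieces of length at most [d]. On each, the squared increment of [M] is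
     at most [e] times the increment, and these increments telescope to at most 1. *)
  pose n := (Num.truncn (x / d)).+1.
  have n0 : (0 : R) < n%:R by rewrite ltr0n.
  have xn : x / n%:R <= d.
    rewrite ler_pdivrMr// mulrC -ler_pdivrMr// ltW//.
    by have /truncn_itv/andP[] : 0 <= x / d by rewrite divr_ge0// ltW.
  have step j : (j <= n)%N -> `|D (j%:R * (x / n%:R)) - D 0| <= C * e * M (j%:R * (x / n%:R)).
    elim: j => [|j IH] jn; first by rewrite mul0r subrr normr0 M0 mulr0.
    have xn0 : 0 <= x / n%:R by rewrite divr_ge0// ltW.
    have e1 : j.+1%:R * (x / n%:R) - j%:R * (x / n%:R) = x / n%:R.
      by rewrite -natr1 mulrDl mul1r addrC addKr.
    have a0 : 0 <= j%:R * (x / n%:R) by rewrite mulr_ge0.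
    have b1 : j.+1%:R * (x / n%:R) <= 1.
      rewrite mulrCA mulrC mulr_ile1 ?divr_ge0 ?ler0n// ?ler_pdivrMr ?mul1r ?ler_nat//.
    have ab : j%:R * (x / n%:R) <= j.+1%:R * (x / n%:R) by rewrite -subr_ge0 e1.
    have h1 := hD _ _ a0 ab b1.
    have h2 := hd _ _ ab; rewrite e1 in h2; have {}h2 := h2 xn.
    have h3 := IH (ltnW jn); have h4 := M_mono ab.
    move: h1 h2 h3 h4; move: (j%:R * _) (j.+1%:R * _) => s t h1 h2 h3 h4.
    have h5 : C * (M t - M s) ^+ 2 <= C * e * (M t - M s).
      by rewrite expr2 -mulrA ler_wpM2l// ler_wpM2r// subr_ge0.
    have := ler_normD (D t - D s) (D s - D 0).
    by rewrite addrA subrK; lra.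
  have := step n (leqnn n); rewrite mulrC divfK ?gt_eqF// => /le_trans; apply.
  by have /andP[_ Mx] := M_itv x; rewrite ler_piMr// mulr_ge0// ltW.
apply/eqP; rewrite -subr_eq0 -normr_eq0 eq_le normr_ge0 andbT.
apply/ler_addgt0Pr => e e0; rewrite add0r.
have C1 : 0 < C + 1 by rewrite ltr_wpDl.
rewrite (le_trans (small (e / (C + 1)) _)) ?divr_gt0//.
by rewrite mulrCA ger_pMr// ler_pdivrMr// mul1r lerDl.
Qed.

(** Integration by parts. The defect vanishes at 0, and freezing the inner primitive at the left end
    of an interval costs an error quadratic in the increment of [M], so [quadratic_increments_cst]
    applies. *)
Lemma primitive_prod f g x : cb f -> cb g -> 0 <= x <= 1 ->
  F (fun y => f y * F g y) x + F (fun y => g y * F f y) x = F f x * F g x.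
Proof.
move=> cf cg x01.
have [C C0 hC] := cb_ubound cf; have [D D0 hD] := cb_ubound cg.
have cF := cb_primitive cf; have cG := cb_primitive cg.
have cfG : cb (fun y => f y * F g y) by exact: cbM.
have cgF : cb (fun y => g y * F f y) by exact: cbM.
suff : F (fun y => f y * F g y) x + F (fun y => g y * F f y) x - F f x * F g x =
    F (fun y => f y * F g y) 0 + F (fun y => g y * F f y) 0 - F f 0 * F g 0.
  by rewrite !primitive0// mulr0 addr0 subr0 => /eqP; rewrite subr_eq0 => /eqP.
apply: (@quadratic_increments_cst (fun x => F (fun y => f y * F g y) x
  + F (fun y => g y * F f y) x - F f x * F g x) (C * D + C * D + C * D)) => // a b a0 ab b1.
have aux (h k : R -> R) (K L : R) : cb h -> cb k -> (forall x, `|h x| <= K) ->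
    (forall x, `|k x| <= L) -> `|F (fun y => h y * F k y) b - F (fun y => h y * F k y) a
      - F k a * (F h b - F h a)| <= K * L * (M b - M a) ^+ 2.
  move=> ch ck hK kL; have cK := cb_primitive ck.
  have -> : F (fun y => h y * F k y) b - F (fun y => h y * F k y) a
      - F k a * (F h b - F h a) = F (fun y => h y * F k y - F k a * h y) b
      - F (fun y => h y * F k y - F k a * h y) a.
    rewrite !primitiveB ?primitiveZ//; try exact: cbM; try exact: cbZ.
    ring.
  have K0 : 0 <= K := le_trans (normr_ge0 _) (hK 0).
  have L0 : 0 <= L := le_trans (normr_ge0 _) (kL 0).
  rewrite expr2 mulrA; apply: primitive_bound => //; first by apply: cbB; [exact: cbM|exact: cbZ].
  move=> y /andP[ay yb] _; rewrite [F k a * _]mulrC -mulrBr normrM -mulrA ler_pM//.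
  have := @primitive_bound _ _ mu01 L k a y ck (ltW ay) (fun y _ _ => kL y).
  move=> /le_trans; apply; rewrite ler_wpM2l// lerD2r; exact: M_mono.
have h1 := aux f g C D cf cg hC hD; have h2 := aux g f D C cg cf hD hC.
have h3 := @primitive_bound _ _ mu01 C f a b cf ab (fun y _ _ => hC y).
have h4 := @primitive_bound _ _ mu01 D g a b cg ab (fun y _ _ => hD y).
have h5 : `|(F f b - F f a) * (F g b - F g a)| <= C * D * (M b - M a) ^+ 2.
  by rewrite normrM (le_trans (ler_pM _ _ h3 h4))// le_eqVlt; apply/orP; left; apply/eqP; ring.
move: h1 h2 h5; move: (F (fun y => f y * F g y) b) (F (fun y => f y * F g y) a)
  (F (fun y => g y * F f y) b) (F (fun y => g y * F f y) a) (M b - M a)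
  (F f b) (F f a) (F g b) (F g a) => r1 r2 r3 r4 m s1 s2 s3 s4.
rewrite !ler_norml => /andP[? ?] /andP[? ?] /andP[? ?]; apply/andP; split; lra.
Qed.

Definition volterra g x : R := N x * F g x - F (fun y => N y * g y) x.

(** Integral form of [d/dmu (du/dN) = - l u] with [u(0) = 0] and
    [du/dN(0) = w]; [slope] below is [du/dN]. *)
Definition string_solution l w u : Prop :=
  cb u /\ forall x, 0 <= x <= 1 -> u x = w * N x - l * volterra u x.

Definition slope l w u x : R := w - l * F u x.

Lemma cb_volterra g : cb g -> cb (volterra g).
Proof.
by move=> cg; apply: cbB; [exact/cbM/cb_primitive|exact/cb_primitive/cbM].
Qed.

Lemma cb_slope l w u : cb u -> cb (slope l w u).
Proof. by move=> cu; apply: cbB; [exact: cb_cst|exact/cbZ/cb_primitive]. Qed.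

(** In place of differentiating, each equation is multiplied by the other solution and integrated;
    [primitive_prod] turns the double integrals into products of primitives, and a polynomial
    identity remains. *)
Lemma wronskian l l' w w' u v x :
  string_solution l w u -> string_solution l' w' v -> 0 <= x <= 1 ->
  slope l w u x * v x - u x * slope l' w' v x
    = (l' - l) * F (fun y => u y * v y) x.
Proof.
move=> [cu eu] [cv ev] x01.
have cNu : cb (fun y => N y * u y) by exact: cbM.
have cNv : cb (fun y => N y * v y) by exact: cbM.
have cFu := cb_primitive cu; have cFv := cb_primitive cv.
have cFNu := cb_primitive cNu; have cFNv := cb_primitive cNv.
have x0 : 0 <= x by case/andP: x01.
have E (a k : R) (f g : R -> R) : cb f -> cb g ->
    (forall y, 0 <= y <= 1 -> f y = a * N y - k * volterra f y) ->
    F (fun y => f y * g y) x = a * F (fun y => N y * g y) x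
      - k * (F (fun y => N y * g y * F f y) x - F (fun y => g y * F (fun z => N z * f z) y) x).
  move=> cf cg ef.
  have c1 : cb (fun y => N y * g y) by exact: cbM.
  have c2 : cb (fun y => N y * g y * F f y) by apply: cbM => //; exact: cb_primitive.
  have c3 : cb (fun y => g y * F (fun z => N z * f z) y).
    by apply: cbM => //; apply: cb_primitive; exact: cbM.
  rewrite -primitiveZ// -primitiveB// -primitiveZ//; last exact: cbB.
  rewrite -primitiveB//; [|exact: cbZ|by apply: cbZ; exact: cbB].
  apply: primitive_eq => //; first exact: cbM.
    by apply: cbB; apply: cbZ => //; exact: cbB.
  by move=> y y01 _; rewrite [in LHS]ef// /volterra; ring.
have E1 := E w l u v cu cv eu.
have E2 := E w' l' v u cv cu ev.
have P1 := primitive_prod cNv cu x01.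
have P2 := primitive_prod cNu cv x01.
have uvC : F (fun y => v y * u y) x = F (fun y => u y * v y) x.
  by congr Rintegral; apply/funext => y; rewrite mulrC.
rewrite uvC in E2; rewrite [RHS]mulrBl; set A := F (fun y => u y * v y) x in E1 E2 *.
(* The integral weighted by [l'] is expanded through the equation for [u], the one weighted by [l]
   through that for [v]: the double integrals then share the factor [l * l'] and cancel. *)
rewrite [l' * A](congr1 ( *%R l') E1) [l * A](congr1 ( *%R l) E2).
rewrite /slope (eu x x01) (ev x x01) /volterra.
have -> : F (fun y => N y * v y * F u y) x = F (fun y => N y * v y) x * F u x
  - F (fun y => u y * F (fun z => N z * v z) y) x by rewrite -P1 addrK.
have -> : F (fun y => N y * u y * F v y) x = F (fun y => N y * u y) x * F v x
  - F (fun y => v y * F (fun z => N z * u z) y) x by rewrite -P2 addrK.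
move: (F _ x) (F _ x) (F _ x) (F _ x) (F _ x) (F _ x) => a1 a2 a3 a4 a5 a6.
ring.
Qed.

Lemma volterra_incr g a b : volterra g b - volterra g a = (N b - N a) * F g a
  + (N b * (F g b - F g a) - (F (fun y => N y * g y) b - F (fun y => N y * g y) a)).
Proof. rewrite /volterra; ring. Qed.

(** Second order: the kernel [N b - N y] is bounded by the increment of [N], and integrating it
    costs the increment of [M]. The points may come in either order, as two-sided expansions at a
    zero require. *)
Lemma volterra_remainder (B : R) g a b : cb g -> 0 <= a <= 1 -> 0 <= b <= 1 ->
  (forall y, Num.min a b <= y <= Num.max a b -> `|g y| <= B) ->
  `|N b * (F g b - F g a) - (F (fun y => N y * g y) b - F (fun y => N y * g y) a)|
    <= B * `|N b - N a| * `|M b - M a|.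
Proof.
move=> cg a01 b01.
have cNg : cb (fun y => N y * g y) by exact: cbM.
have cNbg : cb (fun y => N b * g y) by exact: cbZ.
have E : N b * (F g b - F g a) - (F (fun y => N y * g y) b - F (fun y => N y * g y) a)
    = F (fun y => N b * g y - N y * g y) b - F (fun y => N b * g y - N y * g y) a.
  by rewrite !primitiveB// !primitiveZ//; ring.
rewrite E; have cd := cbB cNbg cNg.
have [ab|/ltW ab] := leP a b => gB.
  rewrite [`|M b - M a|]ger0_norm ?subr_ge0 ?M_mono//.
  apply: primitive_bound => // y /andP[ay yb] _.
  rewrite -mulrBl normrM mulrC ler_pM//; first by apply: gB; rewrite ltW.
  by rewrite !ger0_norm ?subr_ge0 ?N_mono ?lerB// ?N_mono// ltW.
rewrite [`|M b - M a|]distrC [`|M a - M b|]ger0_norm ?subr_ge0 ?M_mono// distrC.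
apply: primitive_bound => // y /andP[ay yb] _.
rewrite -mulrBl normrM mulrC ler_pM//; first by apply: gB; rewrite ltW.
have h1 := N_mono (ltW ay); have h2 := N_mono yb.
by rewrite !ler0_norm; lra.
Qed.

Lemma string_solution_incr l w u a b : string_solution l w u ->
  0 <= a <= 1 -> 0 <= b <= 1 -> u b - u a = slope l w u a * (N b - N a)
  - l * (N b * (F u b - F u a) - (F (fun y => N y * u y) b - F (fun y => N y * u y) a)).
Proof. by move=> [_ eu] a01 b01; rewrite !eu// /volterra /slope; ring. Qed.

(** Differentiability with respect to [N]: since [M] is continuous, the remainder is small compared
    with [N b - N a], so [slope] is the derivative. *)
Lemma string_solution_expansion (B : R) l w u a b : string_solution l w u ->
  (forall y, `|u y| <= B) -> 0 <= a <= 1 -> 0 <= b <= 1 ->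
  `|u b - u a - slope l w u a * (N b - N a)| <= `|l| * (B * `|N b - N a| * `|M b - M a|).
Proof.
move=> su uB a01 b01; rewrite (string_solution_incr su a01 b01) addrAC subrr add0r.
rewrite normrN normrM ler_wpM2l// volterra_remainder//; by case: su.
Qed.

(** * Iterated primitives, Gronwall estimate and Picard iteration *)

Lemma primitive_sum (n : nat) (h : nat -> R -> R) x : (forall i, cb (h i)) ->
  F (fun x => \sum_(0 <= i < n) h i x) x = \sum_(0 <= i < n) F (h i) x.
Proof.
move=> ch; elim: n => [|n IH].
  rewrite big_nil; under eq_fun do rewrite big_nil.
  by rewrite primitive_cst mul0r.
under eq_fun do rewrite big_nat_recr//=.
by rewrite primitiveD ?IH ?big_nat_recr//; exact: cb_sum.
Qed.

(** On [0, 1] this is the n-fold iterated primitive of the constant 1, the source of every factorial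
    and exponential below. *)
Definition mass_term (n : nat) x : R := M x ^+ n / n`!%:R.

Lemma cb_mass_term n : cb (mass_term n).
Proof. by apply: cbM; [exact: cbX|exact: cb_cst]. Qed.

Lemma primitive_mass_term (n : nat) x : 0 <= x <= 1 ->
  F (mass_term n) x = mass_term n.+1 x.
Proof.
elim: n x => [|n IH] x x01.
  rewrite /mass_term fact0 expr1 factS fact0 divr1 -[RHS]mul1r -primitive_cst.
  by congr Rintegral; apply/funext => y; rewrite expr0 divr1.
have x0 : 0 <= x by case/andP: x01.
(* Parts with the constant 1: both terms on the left are multiples of the primitive sought, with
   coefficients 1 and [n.+1], whence the factor [n.+2]. *)
have := primitive_prod (cb_cst 1) (cb_mass_term n) x01.
have -> : F (fun y => 1 * F (mass_term n) y) x = F (mass_term n.+1) x.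
  apply: primitive_eq => //; last by move=> y y01 _; rewrite mul1r IH.
    by apply: cbM; [exact: cb_cst|exact/cb_primitive/cb_mass_term].
  exact: cb_mass_term.
have -> : F (fun y => mass_term n y * F (fun=> 1) y) x = n.+1%:R * F (mass_term n.+1) x.
  rewrite -primitiveZ; last exact: cb_mass_term.
  congr Rintegral; apply/funext => y; rewrite primitive_cst mul1r /mass_term.
  rewrite factS natrM exprSr.
  have : n`!%:R != 0 :> R by rewrite pnatr_eq0 -lt0n fact_gt0.
  have : n.+1%:R != 0 :> R by rewrite pnatr_eq0.
  by move: n.+1%:R n`!%:R => a c a0 c0; field; rewrite ?a0 ?c0.
rewrite IH// primitive_cst mul1r -{1}[F _ x]mul1r -mulrDl nat1r => E.
have n2 : n.+2%:R != 0 :> R by rewrite pnatr_eq0.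
apply: (mulfI n2); rewrite E /mass_term [n.+2`!]factS natrM [in RHS]exprSr.
have : n.+1`!%:R != 0 :> R by rewrite pnatr_eq0 -lt0n fact_gt0.
by move: n.+2%:R n2 n.+1`!%:R => a a0 c c0; field; rewrite ?a0 ?c0.
Qed.

Lemma volterra_le g h x : cb g -> cb h -> 0 <= x <= 1 ->
  (forall y, 0 <= y <= 1 -> `|g y| <= h y) -> `|volterra g x| <= F h x.
Proof.
move=> cg ch x01 gh; have x0 : 0 <= x by case/andP: x01.
have cNg : cb (fun y => N y * g y) by exact: cbM.
have cNxg : cb (fun y => N x * g y) by exact: cbZ.
have -> : volterra g x = F (fun y => N x * g y - N y * g y) x.
  by rewrite primitiveB// primitiveZ.
have cd := cbB cNxg cNg.
have bd y : 0 <= y <= 1 -> y <= x -> `|N x * g y - N y * g y| <= h y.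
  move=> y01 yx; apply: le_trans (gh y y01).
  rewrite -mulrBl normrM ler_piMl// ger0_norm ?subr_ge0 ?N_mono//.
  by have /andP[? ?] := N_itv x; have /andP[? ?] := N_itv y; lra.
rewrite ler_norml; apply/andP; split.
  rewrite -mulN1r -primitiveZ//; apply: primitive_ler => //; first exact: cbZ.
  by move=> y y01 yx; have := bd y y01 yx; rewrite ler_norml mulN1r => /andP[].
apply: primitive_ler => // y y01 yx.
by have := bd y y01 yx; rewrite ler_norml => /andP[].
Qed.

Lemma mass_term_le n x : 0 <= mass_term n x <= n`!%:R^-1.
Proof.
have /andP[M0' M1'] := M_itv x; rewrite /mass_term divr_ge0 ?exprn_ge0//=.
by rewrite -[leRHS]mul1r ler_pM2r ?invr_gt0 ?ltr0n ?fact_gt0// exprn_ile1.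
Qed.

(** Iterating the inequality from the crude bound [D] gives [G] times a partial sum of the
    exponential series plus a remainder of order |l|^n / n!. It serves for uniqueness, for a priori
    bounds and for dependence on [l]. *)
Lemma gronwall_volterra (G : R) l d : cb d ->
  (forall x, 0 <= x <= 1 -> `|d x + l * volterra d x| <= G) ->
  forall x, 0 <= x <= 1 -> `|d x| <= G * expR `|l|.
Proof.
move=> cd hd; have [D D0 dD] := cb_ubound cd.
have G0 : 0 <= G by have := hd 0; rewrite lexx ler01 => /(_ isT); exact: le_trans.
pose h n y := G * \sum_(0 <= i < n) (`|l| ^+ i * mass_term i y)
  + D * `|l| ^+ n * mass_term n y.
have cht i : cb (fun y => `|l| ^+ i * mass_term i y) by apply: cbZ; exact: cb_mass_term.
have ch n : cb (h n).
  by apply: cbD; apply: cbZ; [exact: (cb_sum n cht)|exact: cb_mass_term].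
have dh n x : 0 <= x <= 1 -> `|d x| <= h n x.
  elim: n x => [|n IH] x x01.
    by rewrite /h big_nil mulr0 add0r expr0 mulr1 /mass_term expr0 fact0 divr1 mulr1.
  have := volterra_le cd (ch n) x01 IH.
  have -> : F (h n) x = G * \sum_(0 <= i < n) (`|l| ^+ i * mass_term i.+1 x)
      + D * `|l| ^+ n * mass_term n.+1 x.
    rewrite /h primitiveD; first last.
    - by apply: cbZ; exact: cb_mass_term.
    - by apply: cbZ; exact: (cb_sum n cht).
    rewrite !primitiveZ; first last.
    - exact: (cb_sum n cht).
    - exact: cb_mass_term.
    rewrite (primitive_sum n x cht) primitive_mass_term//; congr (_ * _ + _).
    apply: eq_bigr => i _; rewrite primitiveZ; last exact: cb_mass_term.
    by rewrite primitive_mass_term.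
  rewrite /h big_nat_recl//= expr0 mul1r => hv.
  have E : \sum_(0 <= i < n) (`|l| ^+ i.+1 * mass_term i.+1 x)
      = `|l| * \sum_(0 <= i < n) (`|l| ^+ i * mass_term i.+1 x).
    by rewrite mulr_sumr; apply: eq_bigr => i _; rewrite exprS mulrA.
  have e0 : mass_term 0 x = 1 by rewrite /mass_term expr0 fact0 divr1.
  rewrite E e0 exprS; move: hv; set s := \sum_(_ <= _ < _) _ => hv.
  have : `|l| * `|volterra d x| <= `|l| * (G * s + D * `|l| ^+ n * mass_term n.+1 x).
    by rewrite ler_wpM2l.
  rewrite -normrM => hl; have := hd x x01.
  have := ler_normB (d x + l * volterra d x) (l * volterra d x); rewrite addrK.
  by move=> h1 h2; apply: (le_trans h1); apply: (le_trans (lerD h2 hl));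
    rewrite le_eqVlt; apply/orP; left; apply/eqP; ring.
move=> x x01; apply/ler_addgt0Pr => e e0.
have /cvgrPdist_lt/(_ (e / (D + 1)))[] := cvg_exp_coeff `|l|.
  by rewrite divr_gt0// ltr_wpDl.
move=> n _ /(_ n (leqnn n)); rewrite sub0r normrN ger0_norm ?exp_coeff_ge0// => hn.
apply: (le_trans (dh n x x01)); rewrite /h lerD//.
  rewrite ler_wpM2l// (le_trans _ (exp_series_le n (normr_ge0 l)))//.
  rewrite /series /= ler_sum// => i _; rewrite /exp_coeff ler_wpM2l ?exprn_ge0//.
  by have /andP[] := mass_term_le i x.
have D1 : 0 < D + 1 by rewrite ltr_wpDl.
rewrite ltr_pdivlMr// in hn; have {}hn := ltW hn; rewrite (le_trans _ hn)//.
have /andP[m0 m1] := mass_term_le n x.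
have : `|l| ^+ n * mass_term n x <= exp_coeff `|l| n by rewrite /exp_coeff ler_wpM2l// exprn_ge0.
have : 0 <= `|l| ^+ n * mass_term n x by rewrite mulr_ge0// exprn_ge0.
rewrite -mulrA; move: (_ ^+ n * _) (exp_coeff _ _) => s t s0 st; nra.
Qed.

Lemma volterraB g h x : cb g -> cb h ->
  volterra (fun y => g y - h y) x = volterra g x - volterra h x.
Proof.
move=> cg ch; rewrite /volterra primitiveB//.
have -> : F (fun y => N y * (g y - h y)) x = F (fun y => N y * g y - N y * h y) x.
  by congr Rintegral; apply/funext => y; rewrite mulrBr.
by rewrite primitiveB; [ring|exact: cbM|exact: cbM].
Qed.

Lemma volterraZ (c : R) g x : cb g -> volterra (fun y => c * g y) x = c * volterra g x.
Proof.
move=> cg; rewrite /volterra primitiveZ//.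
have -> : F (fun y => N y * (c * g y)) x = F (fun y => c * (N y * g y)) x.
  by congr Rintegral; apply/funext => y; rewrite mulrCA.
by rewrite primitiveZ; [ring|exact: cbM].
Qed.

Fixpoint picard l (k : nat) : R -> R :=
  if k is k'.+1 then fun x => N x - l * volterra (picard l k') x else fun=> 0.

Lemma cb_picard l k : cb (picard l k).
Proof.
elim: k => [|k IH]; first exact: cb_cst.
by apply: cbB => //; apply: cbZ; exact: cb_volterra.
Qed.

Lemma picard_step l k x : 0 <= x <= 1 ->
  `|picard l k.+1 x - picard l k x| <= `|l| ^+ k * mass_term k x.
Proof.
elim: k x => [|k IH] x x01.
  rewrite /= subr0 expr0 mul1r /mass_term expr0 fact0 divr1.
  have -> : volterra (fun=> 0) x = 0.
    rewrite /volterra primitive_cst mul0r mulr0.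
    have -> : F (fun y => N y * 0) x = F (fun=> 0) x.
      by congr Rintegral; apply/funext => y; rewrite mulr0.
    by rewrite primitive_cst mul0r subrr.
  by rewrite mulr0 subr0; have /andP[n0 n1] := N_itv x; rewrite ger0_norm.
have -> : picard l k.+2 x - picard l k.+1 x
    = - (l * volterra (fun y => picard l k.+1 y - picard l k y) x).
  by rewrite volterraB; [rewrite /=; ring|exact: cb_picard|exact: cb_picard].
have cd : cb (fun y => picard l k.+1 y - picard l k y).
  by apply: cbB; exact: cb_picard.
have ch : cb (fun y => `|l| ^+ k * mass_term k y).
  by apply: cbZ; exact: cb_mass_term.
have := volterra_le cd ch x01 IH.
rewrite primitiveZ ?primitive_mass_term//; last exact: cb_mass_term.
by rewrite normrN normrM exprS -mulrA; exact: ler_wpM2l.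
Qed.

Lemma picard_step_exp l k x : 0 <= x <= 1 ->
  `|picard l k.+1 x - picard l k x| <= exp_coeff `|l| k.
Proof.
move=> x01; apply: (le_trans (picard_step l k x01)).
by rewrite /exp_coeff /= ler_wpM2l ?exprn_ge0//; have /andP[] := mass_term_le k x.
Qed.

Lemma picard_dist l (k j : nat) x : 0 <= x <= 1 -> (k <= j)%N ->
  `|picard l j x - picard l k x|
    <= series (exp_coeff `|l|) j - series (exp_coeff `|l|) k.
Proof.
move=> x01 /subnKC <-; elim: (j - k)%N => [|d IH].
  by rewrite addn0 !subrr normr0.
rewrite addnS; have h1 := picard_step_exp l (k + d) x01.
have h2 := ler_normD (picard l (k + d).+1 x - picard l (k + d) x)
  (picard l (k + d) x - picard l k x); rewrite addrA subrK in h2.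
apply: (le_trans h2); apply: (le_trans (lerD h1 IH)).
by rewrite [series _ (k + d).+1]seriesSr; lra.
Qed.

Lemma picard_cvg l x : 0 <= x <= 1 -> cvgn (picard l ^~ x).
Proof.
move=> x01; have -> : picard l ^~ x = series (fun n => picard l n.+1 x - picard l n x).
  apply/funext => n; rewrite /series /= telescope_sumr//; last first.
  by rewrite /= subr0.
apply: normed_cvg; apply: (@series_le_cvg _ _ (exp_coeff `|l|)).
- by move=> n; exact: normr_ge0.
- by move=> n; exact: exp_coeff_ge0.
- by move=> n; exact: picard_step_exp.
- exact: is_cvg_series_exp_coeff.
Qed.

(** Convergence is established on [0, 1] only; [clamp] freezes the limit outside, so that it is
    continuous and bounded on the line. *)
Definition picard_lim l x : R := limn (picard l ^~ (clamp x)).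

Definition picard_tail l k : R := expR `|l| - series (exp_coeff `|l|) k.

Lemma picard_lim_dist l k x : 0 <= x <= 1 ->
  `|picard_lim l x - picard l k x| <= picard_tail l k.
Proof.
move=> x01; rewrite /picard_lim clamp_id//; apply/ler_addgt0Pr => e e0.
have /cvgrPdist_le/(_ e e0)[n _ hn] : picard l ^~ x @ \oo --> limn (picard l ^~ x).
  exact: picard_cvg.
have := hn (maxn n k) (leq_maxl _ _) => /= h1.
have h2 := picard_dist l x01 (leq_maxr n k).
have h3 := exp_series_le (maxn n k) (normr_ge0 l).
have := ler_normD (limn (picard l ^~ x) - picard l (maxn n k) x)
  (picard l (maxn n k) x - picard l k x); rewrite addrA subrK /picard_tail.
lra.
Qed.

Lemma picard_tail_small l (e : R) : 0 < e ->
  exists k : nat, picard_tail l k <= e /\ picard_tail l k.+1 <= e.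
Proof.
move=> e0; have : series (exp_coeff `|l|) @ \oo --> expR `|l|.
  exact: is_cvg_series_exp_coeff.
move=> /cvgrPdist_le/(_ e e0)[n _ hn]; exists n; rewrite /picard_tail.
have := hn n (leqnn n); have := hn n.+1 (leqnSn n) => /=.
by rewrite !ler_norml => /andP[_ ->] /andP[_ ->].
Qed.

Lemma picard_le_exp l k x : 0 <= x <= 1 -> `|picard l k x| <= expR `|l|.
Proof.
move=> x01; have := picard_dist l x01 (leq0n k); rewrite /= subr0.
rewrite {2}/series /= big_nil subr0 => /le_trans; apply; exact: exp_series_le.
Qed.

(** The constant does not depend on [k], so the estimate passes to the limit and yields its
    continuity. *)
Lemma picard_lipschitz l k a b : 0 <= a -> a <= b -> b <= 1 ->
  `|picard l k b - picard l k a| <= (1 + `|l| * (2 * expR `|l|)) * (N b - N a).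
Proof.
move=> a0 ab b1; have Nab := N_mono ab.
have E0 : 0 <= expR `|l| by rewrite ltW// expR_gt0.
have l0 := normr_ge0 l.
case: k => [|k].
  by rewrite subrr normr0 mulr_ge0 ?subr_ge0// addr_ge0// mulr_ge0// mulr_ge0.
have a01 : 0 <= a <= 1 by rewrite a0 (le_trans ab).
have b01 : 0 <= b <= 1 by rewrite b1 (le_trans a0).
have cg := cb_picard l k; set g := picard l k in cg *.
have gB y : 0 <= y <= 1 -> `|g y| <= expR `|l| by exact: picard_le_exp.
have -> : picard l k.+1 b - picard l k.+1 a
    = (N b - N a) - l * (volterra g b - volterra g a) by rewrite /= -/g; ring.
rewrite volterra_incr.
have h1 : `|(N b - N a) * F g a| <= expR `|l| * (N b - N a).
  rewrite normrM [`|N b - N a|]ger0_norm ?subr_ge0// mulrC ler_wpM2r ?subr_ge0//.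
  exact: primitive_norm.
have := @volterra_remainder (expR `|l|) g a b cg a01 b01.
have gB' : forall y, Num.min a b <= y <= Num.max a b -> `|g y| <= expR `|l|.
  move=> y; rewrite min_l// max_r// => /andP[ay yb]; apply: gB.
  by rewrite (le_trans a0)// (le_trans yb).
move=> /(_ gB'); set r := N b * _ - _ => hr.
have h2 : `|r| <= expR `|l| * (N b - N a).
  apply: (le_trans hr); rewrite (ger0_norm (_ : 0 <= N b - N a)) ?subr_ge0//.
  rewrite ler_piMr ?mulr_ge0 ?subr_ge0// ger0_norm ?subr_ge0 ?M_mono//.
  by have /andP[? ?] := M_itv a; have /andP[? ?] := M_itv b; lra.
have h3 : `|l * ((N b - N a) * F g a + r)| <= `|l| * (2 * expR `|l|) * (N b - N a).
  rewrite normrM -mulrA ler_wpM2l// (le_trans (ler_normD _ _))//.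
  by rewrite (le_trans (lerD h1 h2))//; lra.
rewrite (le_trans (ler_normB _ _))// [leRHS]mulrDl mul1r lerD//.
by rewrite ger0_norm ?subr_ge0.
Qed.

Lemma cb_picard_lim l : cb (picard_lim l).
Proof.
split.
  apply: (@dominated_continuous _ N _ (1 + `|l| * (2 * expR `|l|))) => // a b ab.
  rewrite -(cell_cdf_clamp a hN) -(cell_cdf_clamp b hN).
  have /andP[a0 a1] := clamp_itv a; have /andP[b0 b1] := clamp_itv b.
  apply/ler_addgt0Pr => e e0; have e20 : 0 < e / 2 by lra.
  have [k [hk _]] := picard_tail_small l e20.
  have := picard_lipschitz l k a0 (clamp_mono ab) b1.
  have := picard_lim_dist l k (clamp_itv a); have := picard_lim_dist l k (clamp_itv b).
  rewrite /picard_lim !(clamp_id (clamp_itv _)).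
  move: (limn _) (limn _) (picard _ _ _) (picard _ _ _) (_ * (N _ - N _)) => r1 r2 r3 r4 r5.
  rewrite !ler_norml => /andP[? ?] /andP[? ?] /andP[? ?]; apply/andP; split; lra.
exists (expR `|l|) => x; apply/ler_addgt0Pr => e e0.
have [k [hk _]] := picard_tail_small l e0.
have := picard_lim_dist l k (clamp_itv x); have := picard_le_exp l k (clamp_itv x).
rewrite /picard_lim !(clamp_id (clamp_itv _)) => h1 h2.
have := ler_normD (limn (picard l ^~ (clamp x)) - picard l k (clamp x)) (picard l k (clamp x)).
by rewrite subrK; lra.
Qed.

Lemma picard_lim_solution l : string_solution l 1 (picard_lim l).
Proof.
have cu := cb_picard_lim l; split => // x x01.
apply/eqP; rewrite -subr_eq0 -normr_eq0 eq_le normr_ge0 andbT.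
apply/ler_addgt0Pr => e e0; rewrite add0r mul1r.
have l1 : 0 < 1 + `|l| by rewrite ltr_pwDl.
(* The residual of the limit is at most the tail at [k.+1] plus |l| times the tail at [k], hence the
   accuracy [e / (1 + |l|)]. *)
have [k [hk hk1]] := picard_tail_small l (divr_gt0 e0 l1).
have h1 := picard_lim_dist l k.+1 x01.
have cd : cb (fun y => picard_lim l y - picard l k y) by apply: cbB => //; exact: cb_picard.
have t0 : 0 <= picard_tail l k by rewrite subr_ge0 exp_series_le.
have h2 : `|volterra (fun y => picard_lim l y - picard l k y) x| <= picard_tail l k.
  apply: (le_trans (volterra_le cd (cb_cst (picard_tail l k)) x01 _)).
    by move=> y y01; exact: picard_lim_dist.
  rewrite primitive_cst ler_piMr//; by have /andP[] := M_itv x.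
rewrite volterraB// in h2; last exact: cb_picard.
have -> : picard_lim l x - (N x - l * volterra (picard_lim l) x) =
    (picard_lim l x - picard l k.+1 x)
    + l * (volterra (picard_lim l) x - volterra (picard l k) x) by rewrite /=; ring.
rewrite (le_trans (ler_normD _ _))// normrM.
have h3 : `|l| * `|volterra (picard_lim l) x - volterra (picard l k) x| <= `|l| * picard_tail l k.
  by rewrite ler_wpM2l.
have h4 : `|l| * picard_tail l k <= `|l| * (e / (1 + `|l|)) by rewrite ler_wpM2l.
have <- : e / (1 + `|l|) + `|l| * (e / (1 + `|l|)) = e.
  by field; rewrite gt_eqF.
lra.
Qed.

Lemma string_solutionZ (c : R) l w u : string_solution l w u ->
  string_solution l (c * w) (fun x => c * u x).
Proof.
move=> [cu eu]; split; first exact: cbZ.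
by move=> x x01; rewrite volterraZ// [in LHS]eu//; ring.
Qed.

Lemma slopeZ (c : R) l w u x : cb u ->
  slope l (c * w) (fun x => c * u x) x = c * slope l w u x.
Proof. by move=> cu; rewrite /slope primitiveZ//; ring. Qed.

Lemma string_solution0 l w u : string_solution l w u -> u 0 = 0.
Proof.
move=> [cu ->]; last by rewrite lexx ler01.
by rewrite /volterra !primitive0 ?N0//; [ring|exact: cbM].
Qed.

Lemma slope0 l w u : cb u -> slope l w u 0 = w.
Proof. by move=> cu; rewrite /slope primitive0// mulr0 subr0. Qed.

(** The difference solves the homogeneous Volterra equation, to which Gronwall applies with [G = 0].
    This is the one-dimensionality of eigenspaces. *)
Lemma string_solution_unique l w u x : string_solution l w u -> 0 <= x <= 1 ->
  u x = w * picard_lim l x.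
Proof.
move=> [cu eu] x01; have [cp ep] := picard_lim_solution l.
have cd : cb (fun y => u y - w * picard_lim l y) by apply: cbB => //; exact: cbZ.
apply/eqP; rewrite -subr_eq0 -normr_eq0 eq_le normr_ge0 andbT.
have := @gronwall_volterra 0 l _ cd _ x x01; rewrite mul0r; apply=> y y01.
rewrite volterraB//; last exact: cbZ.
rewrite volterraZ// (eu y y01) {1}(ep y y01).
by rewrite (_ : _ + _ = 0) ?normr0//; ring.
Qed.

Lemma slope_unique l w u x : string_solution l w u -> 0 <= x <= 1 ->
  slope l w u x = w * slope l 1 (picard_lim l) x.
Proof.
move=> su x01; have cp := cb_picard_lim l; rewrite -slopeZ// mulr1 /slope.
congr (_ - _ * _); apply: primitive_eq; [by case: su|exact: cbZ|by case/andP: x01|].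
by move=> y y01 _; exact: string_solution_unique.
Qed.

Lemma picard_lim_le l x : 0 <= x <= 1 -> `|picard_lim l x| <= expR `|l|.
Proof.
move=> x01; have [cp ep] := picard_lim_solution l.
have := @gronwall_volterra 1 l _ cp _ x x01; rewrite mul1r; apply=> y y01.
rewrite {1}ep// subrK mul1r; have /andP[n0 n1] := N_itv y; by rewrite ger0_norm.
Qed.

(** The difference solves a Volterra equation with source [(l' - l) * volterra (picard_lim l')]. One
    factor [expR L] bounds that source, the other comes from Gronwall. *)
Lemma picard_lim_lipschitz (L : R) l l' x : `|l| <= L -> `|l'| <= L -> 0 <= x <= 1 ->
  `|picard_lim l x - picard_lim l' x| <= `|l - l'| * (expR L * expR L).
Proof.
move=> lL l'L x01; have [cp ep] := picard_lim_solution l.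
have [cp' ep'] := picard_lim_solution l'.
have cd := cbB cp cp'.
have := @gronwall_volterra (`|l - l'| * expR L) l _ cd _ x x01.
move=> h; rewrite (le_trans (h _))//.
  move=> y y01; rewrite volterraB// ep// [picard_lim l' y]ep'//.
  rewrite [X in `|X|](_ : _ = (l' - l) * volterra (picard_lim l') y); last by ring.
  rewrite normrM distrC ler_wpM2l//.
  apply: (le_trans (volterra_le cp' (cb_cst (expR L)) y01 _)).
    by move=> z z01; rewrite (le_trans (picard_lim_le _ _))// ler_expR.
  by rewrite primitive_cst ler_piMr ?expR_ge0//; have /andP[] := M_itv y.
by rewrite mulrA ler_wpM2l ?ler_expR// mulr_ge0// expR_ge0.
Qed.

Lemma picard_lim_continuous l (e : R) : 0 < e -> exists2 d : R, 0 < d &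
  forall l', `|l' - l| <= d -> forall x, 0 <= x <= 1 ->
    `|picard_lim l' x - picard_lim l x| <= e
    /\ `|slope l' 1 (picard_lim l') x - slope l 1 (picard_lim l) x| <= e.
Proof.
move=> e0; pose L := `|l| + 1; pose K := expR L * expR L.
have K0 : 0 < K by rewrite mulr_gt0 ?expR_gt0.
have L0 : 0 < L by rewrite ltr_wpDl.
(* [K] is the Lipschitz constant in [l] of the values and [expR L + L * K] that of the slopes; this
   quantity dominates both. *)
have KK : 0 < expR L + (L + 1) * K by rewrite addr_gt0 ?expR_gt0// mulr_gt0// addr_gt0.
have eK : 0 < e / (expR L + (L + 1) * K) by rewrite divr_gt0.
exists (Num.min 1 (e / (expR L + (L + 1) * K))); first by rewrite lt_min ltr01.
move=> l'; rewrite le_min ler_pdivlMr// => /andP[l1 le] x x01.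
have l'L : `|l'| <= L.
  by have := ler_normD (l' - l) l; rewrite subrK /L; lra.
have lL : `|l| <= L by rewrite /L; lra.
have hp y : 0 <= y <= 1 -> `|picard_lim l' y - picard_lim l y| <= `|l' - l| * K.
  exact: picard_lim_lipschitz.
have n0 := normr_ge0 (l' - l).
split.
  apply: (le_trans (hp x x01)); apply: le_trans le; rewrite ler_wpM2l//.
  have := expR_gt0 L; nra.
have cp := cb_picard_lim l; have cp' := cb_picard_lim l'.
have -> : slope l' 1 (picard_lim l') x - slope l 1 (picard_lim l) x =
    - ((l' - l) * F (picard_lim l) x
       + l' * F (fun y => picard_lim l' y - picard_lim l y) x).
  by rewrite /slope primitiveB//; ring.
rewrite normrN (le_trans (ler_normD _ _))// !normrM.
have h1 : `|F (picard_lim l) x| <= expR L.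
  apply: primitive_norm; [exact: cp|exact: expR_ge0|].
  by move=> y y01; rewrite (le_trans (picard_lim_le _ _))// ler_expR.
have h2 : `|F (fun y => picard_lim l' y - picard_lim l y) x| <= `|l' - l| * K.
  by apply: primitive_norm => //; [exact: cbB|rewrite mulr_ge0// ltW].
apply: (le_trans (lerD (ler_wpM2l n0 h1) (ler_pM (normr_ge0 _) (normr_ge0 _) l'L h2))).
apply: le_trans le; nra.
Qed.

(* The Wronskian of the solutions for [l] and [l'], divided by [l' - l], tends
   to the integral of the squared solution over [0, z]; a double zero at [z]
   would therefore make the solution vanish on [0, z]. *)
Lemma picard_lim_simple l z : 0 <= z <= 1 -> picard_lim l z = 0 ->
  slope l 1 (picard_lim l) z <> 0.
Proof.
move=> z01 pz sz; have [cp ep] := picard_lim_solution l.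
have [z0|z0] := eqVneq z 0.
  by move: sz; rewrite z0 slope0// => /eqP; rewrite oner_eq0.
have {}z0 : 0 < z by rewrite lt_neqAle eq_sym z0; case/andP: z01.
have cpp : cb (fun y => picard_lim l y * picard_lim l y) by exact: cbM.
have Fz : F (fun y => picard_lim l y * picard_lim l y) z = 0.
  apply/eqP; rewrite -normr_eq0 eq_le normr_ge0 andbT.
  apply/ler_addgt0Pr => e e0; rewrite add0r.
  have E0 : 0 < expR `|l| by exact: expR_gt0.
  have [d d0 hd] := picard_lim_continuous l (divr_gt0 e0 E0).
  have ldl : `|l + d - l| <= d by rewrite addrC addKr ger0_norm// ltW.
  have cp' := cb_picard_lim (l + d).
  have cpp' : cb (fun y => picard_lim l y * picard_lim (l + d) y) by exact: cbM.
  have W := wronskian (picard_lim_solution l) (picard_lim_solution (l + d)) z01.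
  have {}W : F (fun y => picard_lim l y * picard_lim (l + d) y) z = 0.
    move: W; rewrite pz sz !mul0r subrr [l + d]addrC addrK => /esym/eqP.
    by rewrite mulf_eq0 gt_eqF//= => /eqP.
  rewrite -[F _ z]subr0 -W -primitiveB//; apply: primitive_norm; first exact: cbB.
    exact: ltW.
  move=> y y01; rewrite -mulrBr normrM distrC.
  have [h _] := hd _ ldl y y01.
  rewrite (le_trans (ler_pM (normr_ge0 _) (normr_ge0 _) (picard_lim_le l y01) h))//.
  by rewrite mulrC divfK// gt_eqF.
have pp y : 0 < y < z -> picard_lim l y = 0.
  move=> /andP[y0 yz]; apply/eqP/negPn/negP => py.
  have := @primitive_pos (fun y => picard_lim l y * picard_lim l y) 0 z y cpp (lexx _) y0 yz.
  rewrite Fz primitive0// ltxx; case/andP: z01 => _ z1 /(_ z1) h; suff : false by [].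
  by apply: h => [x _|]; rewrite -expr2 ?sqr_ge0// exprn_even_gt0.
(* With the solution zero on [0, c], its equation at [c] reduces to [N c = 0], against strict growth
   of [N]. *)
pose c := z / 2; have c01 : 0 <= c <= 1 by rewrite /c; case/andP: z01 => ? ?; lra.
have : picard_lim l c = 0 by apply: pp; rewrite /c; lra.
rewrite ep// mul1r.
have p0 y : 0 <= y <= 1 -> y <= c -> picard_lim l y = 0.
  move=> /andP[y0 _] yc; have [->|yn0] := eqVneq y 0.
    exact: string_solution0 (picard_lim_solution l).
  by apply: pp; rewrite lt_neqAle eq_sym yn0 y0/=; rewrite /c in yc; lra.
have cz := cb_cst (0 : R); have c0 : 0 <= c by case/andP: c01.
have -> : volterra (picard_lim l) c = 0.
  rewrite /volterra (primitive_eq cp cz c0 p0) primitive_cst mul0r mulr0.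
  rewrite (@primitive_eq _ (fun=> 0) c (cbM cb_N cp) cz c0); last first.
    by move=> y y01 yc; rewrite p0// mulr0.
  by rewrite primitive_cst mul0r subrr.
rewrite mulr0 subr0 => Nc; have := @cell_cdf_lt _ N 0 c hN (lexx _).
rewrite Nc N0 ltxx => h; suff : false by [].
by apply: h; [rewrite /c; lra|case/andP: c01].
Qed.

Lemma string_solution_simple l w u z : string_solution l w u -> w != 0 ->
  0 <= z <= 1 -> u z = 0 -> slope l w u z != 0.
Proof.
move=> su w0 z01; rewrite (string_solution_unique su z01) (slope_unique su z01) => /eqP.
rewrite !mulf_eq0 (negbTE w0)/= => /eqP pz; apply/eqP.
exact: picard_lim_simple.
Qed.

(** The factor 1/2 lets the linear term decide the sign: near a zero with nonzero slope, [u] has the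
    sign of the slope times [N x - N z]. *)
Lemma string_solution_near l w u z : string_solution l w u -> 0 <= z <= 1 ->
  slope l w u z != 0 -> exists2 d : R, 0 < d & forall x, 0 <= x <= 1 -> `|x - z| <= d ->
    `|u x - u z - slope l w u z * (N x - N z)| <= `|slope l w u z| / 2 * `|N x - N z|.
Proof.
move=> su z01 s0; have [B B0 hB] := cb_ubound su.1.
have K0 : 0 < `|l| * B + 1 by rewrite ltr_wpDl// mulr_ge0.
have s0' : 0 < `|slope l w u z| / 2 / (`|l| * B + 1) by rewrite !divr_gt0// normr_gt0.
have [d d0 hd] := cell_cdf_unif hM s0'.
exists d => // x x01 xz.
apply: (le_trans (string_solution_expansion su hB z01 x01)).
rewrite (_ : `|l| * _ = `|l| * B * `|M x - M z| * `|N x - N z|); last by ring.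
rewrite ler_wpM2r//.
have : `|M x - M z| <= `|slope l w u z| / 2 / (`|l| * B + 1).
  have [le|/ltW le] := leP z x.
    by rewrite ger0_norm ?subr_ge0 ?M_mono// hd//; rewrite ger0_norm ?subr_ge0 in xz.
  rewrite distrC ger0_norm ?subr_ge0 ?M_mono// hd//.
  by rewrite distrC ger0_norm ?subr_ge0 in xz.
rewrite ler_pdivlMr//; apply: le_trans.
by rewrite mulrC ler_wpM2l// lerDl.
Qed.

(** * Sturm comparison *)

Lemma slope_ge0 l w u a b : string_solution l w u -> 0 <= a -> a < b -> b <= 1 ->
  u a = 0 -> (forall y, a < y < b -> 0 < u y) -> 0 <= slope l w u a.
Proof.
move=> su a0 ab b1 ua u0; rewrite leNgt; apply/negP => s0.
have a01 : 0 <= a <= 1 by rewrite a0; lra.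
have [d d0 hd] := string_solution_near su a01 (ltr0_neq0 s0).
pose x := Num.min (a + d) ((a + b) / 2).
have xa : a < x by rewrite lt_min; apply/andP; split; lra.
have xb : x <= (a + b) / 2 by rewrite ge_min lexx orbT.
have xd : x <= a + d by rewrite ge_min lexx.
have := hd x; rewrite ua subr0 [`|slope l w u a|]ltr0_norm// => /(_ ltac:(lra)).
rewrite ger0_norm; last lra.
move=> /(_ ltac:(lra)); have Nx : N a < N x by apply: (cell_cdf_lt hN); lra.
rewrite (ger0_norm (_ : 0 <= N x - N a)); last by rewrite subr_ge0 ltW.
rewrite ler_norml => /andP[_]; have := u0 x ltac:(lra).
by move: s0 Nx; move: (slope _ _ _ _) (N x) (N a) => s r1 r2 s0 Nx; nra.
Qed.

Lemma slope_le0 l w u a b : string_solution l w u -> 0 <= a -> a < b -> b <= 1 ->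
  u b = 0 -> (forall y, a < y < b -> 0 < u y) -> slope l w u b <= 0.
Proof.
move=> su a0 ab b1 ub u0; rewrite leNgt; apply/negP => s0.
have b01 : 0 <= b <= 1 by rewrite b1 andbT; lra.
have [d d0 hd] := string_solution_near su b01 (lt0r_neq0 s0).
pose x := Num.max (b - d) ((a + b) / 2).
have xb : x < b by rewrite gt_max; apply/andP; split; lra.
have xa : (a + b) / 2 <= x by rewrite le_max lexx orbT.
have xd : b - d <= x by rewrite le_max lexx.
have := hd x; rewrite ub subr0 [`|slope l w u b|]gtr0_norm// => /(_ ltac:(lra)).
rewrite ler0_norm; last lra.
move=> /(_ ltac:(lra)); have Nx : N x < N b by apply: (cell_cdf_lt hN); lra.
rewrite (ler0_norm (_ : N x - N b <= 0)); last by rewrite subr_le0 ltW.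
rewrite ler_norml => /andP[_]; have := u0 x ltac:(lra).
by move: s0 Nx; move: (slope _ _ _ _) (N x) (N b) => s r1 r2 s0 Nx; nra.
Qed.

(** The Wronskian reduces to slope times [v] at both ends: nonnegative at [a], nonpositive at [b].
    Yet it is [l' - l] times a primitive that strictly increases between them. *)
Lemma sturm_positive l l' w w' u v a b : l < l' ->
  string_solution l w u -> string_solution l' w' v -> 0 <= a -> a < b -> b <= 1 ->
  u a = 0 -> u b = 0 -> (forall y, a < y < b -> 0 < u y) ->
  ~ (forall y, a < y < b -> 0 < v y).
Proof.
move=> ll' su sv a0 ab b1 ua ub u0 v0.
have cu := su.1; have cv := sv.1; have cuv : cb (fun y => u y * v y) by exact: cbM.
have u0' := continuous_ge0_itvcc cu.1 ab u0; have v0' := continuous_ge0_itvcc cv.1 ab v0.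
have a01 : 0 <= a <= 1 by rewrite a0; lra.
have b01 : 0 <= b <= 1 by rewrite b1 andbT; lra.
have Wa := wronskian su sv a01; have Wb := wronskian su sv b01.
rewrite ua mul0r subr0 in Wa; rewrite ub mul0r subr0 in Wb.
have sa := slope_ge0 su a0 ab b1 ua u0; have sb := slope_le0 su a0 ab b1 ub u0.
have va : 0 <= v a by apply: v0'; lra.
have vb : 0 <= v b by apply: v0'; lra.
have h1 := mulr_ge0 sa va; have h2 := mulr_le0_ge0 sb vb.
have := @primitive_pos (fun y => u y * v y) a b ((a + b) / 2) cuv a0 ltac:(lra) ltac:(lra) b1.
move=> /(_ _ _)-h; have : F (fun y => u y * v y) a < F (fun y => u y * v y) b.
  apply: h => [y yab|]; first by rewrite mulr_ge0 ?u0' ?v0'.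
  by rewrite mulr_gt0 ?u0 ?v0//; lra.
rewrite Wa in h1; rewrite Wb in h2.
by move: h1 h2; rewrite -subr_gt0 in ll'; rewrite pmulr_rge0// pmulr_rle0//; lra.
Qed.

(** The comparison argument needs [u] of one sign, while [a] and [b] need not be consecutive zeros.
    The nonzero slope keeps other zeros away from [a], so the infimum of the later ones exceeds [a]
    and is a zero by continuity. *)
Lemma next_zero l w u a b : string_solution l w u -> w != 0 ->
  0 <= a -> a < b -> b <= 1 -> u a = 0 -> u b = 0 ->
  exists c, [/\ a < c, c <= b, u c = 0 & forall y, a < y < c -> u y != 0].
Proof.
move=> su w0 a0 ab b1 ua ub.
have a01 : 0 <= a <= 1 by rewrite a0; lra.
have s0 := string_solution_simple su w0 a01 ua.
have [d d0 hd] := string_solution_near su a01 s0.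
have near_a x : a < x -> x <= a + d -> x <= 1 -> u x != 0.
  move=> ax xd x1; apply/eqP => ux.
  have := hd x; rewrite ux ua subrr sub0r normrN normrM => /(_ ltac:(lra)).
  rewrite [`|x - a|]gtr0_norm; last lra.
  move=> /(_ ltac:(lra)); have Nx : N a < N x by apply: (cell_cdf_lt hN); lra.
  have n0 : 0 < `|N x - N a| by rewrite normr_gt0 subr_eq0 gt_eqF.
  rewrite ler_pM2r//; have : 0 < `|slope l w u a| by rewrite normr_gt0.
  lra.
pose Z := [set x | a + d <= x <= b /\ u x = 0].
have Zb : Z b.
  split => //; rewrite lexx andbT leNgt; apply/negP => bd.
  by have := near_a b ab (ltW bd) b1; rewrite ub eqxx.
have Zlb : has_lbound Z by exists a => x [/andP[? _] _]; lra.
have Zinf : has_inf Z by split; [exists b|].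
have cb_ : inf Z <= b by apply: ge_inf.
have cd : a + d <= inf Z by apply: lb_le_inf; [exists b|move=> x [/andP[]]].
exists (inf Z); split => //; first lra.
  apply/eqP/negPn/negP => uc.
  have /cvgrPdist_lt/(_ `|u (inf Z)|) := su.1.1 (inf Z).
  rewrite normr_gt0 => /(_ uc)/nbhs_ballP[e /= e0 he].
  have [x [xab ux] xe] := inf_adherent e0 Zinf.
  have : `|u (inf Z) - u x| < `|u (inf Z)|.
    apply: he; rewrite /ball/= ltr_norml; apply/andP.
    have : inf Z <= x by apply: ge_inf.
    by split; lra.
  by rewrite ux subr0 ltxx.
move=> y /andP[ay yc]; have [yd|yd] := leP y (a + d).
  by apply: near_a => //; lra.
apply/eqP => uy; have : inf Z <= y by apply: ge_inf => //; split => //; lra.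
lra.
Qed.

Lemma string_solutionN l w u : string_solution l w u ->
  string_solution l (- w) (fun x => - u x).
Proof.
move=> /(string_solutionZ (-1)); rewrite mulN1r.
by under eq_fun do rewrite mulN1r.
Qed.

Lemma slopeN l w u x : cb u ->
  slope l (- w) (fun y => - u y) x = - slope l w u x.
Proof.
move=> cu; rewrite /slope.
have -> : F (fun y => - u y) x = - F u x.
  rewrite -mulN1r -primitiveZ//; congr Rintegral; apply/funext => y.
  by rewrite mulN1r.
ring.
Qed.

Lemma sturm_comparison l l' w w' u v a b : l < l' ->
  string_solution l w u -> w != 0 -> string_solution l' w' v ->
  0 <= a -> a < b -> b <= 1 -> u a = 0 -> u b = 0 ->
  exists2 z, a < z < b & v z = 0.
Proof.
move=> ll' su w0 sv a0 ab b1 ua ub; apply: contrapT => nz.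
have v0 y : a < y < b -> v y != 0.
  by move=> yab; apply/eqP => vy; apply: nz; exists y.
have [c [ac cb_ uc uc0]] := next_zero su w0 a0 ab b1 ua ub.
have c1 : c <= 1 by lra.
have vc0 y : a < y < c -> v y != 0 by move=> yac; apply: v0; lra.
have [up|un] := continuous_sign su.1.1 ac uc0;
  have [vp|vn] := continuous_sign sv.1.1 ac vc0.
- exact: (sturm_positive ll' su sv a0 ac c1 ua uc).
- apply: (sturm_positive ll' su (string_solutionN sv) a0 ac c1 ua uc) => // y yac.
  by rewrite oppr_gt0 vn.
- apply: (sturm_positive ll' (string_solutionN su) sv a0 ac c1); rewrite ?ua ?uc ?oppr0//.
  by move=> y yac; rewrite oppr_gt0 un.
- apply: (sturm_positive ll' (string_solutionN su) (string_solutionN sv) a0 ac c1);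
    rewrite ?ua ?uc ?oppr0// => y yac; by rewrite oppr_gt0 (un, vn).
Qed.

Lemma scale_solution : string_solution 0 1 N.
Proof. by split => // x _; rewrite mul0r subr0 mul1r. Qed.

(** [N] is the solution for parameter 0 and has no zero in (0, 1]; comparison with a negative [l]
    would force one. *)
Lemma string_solution_zero_gt0 l w u z : string_solution l w u -> w != 0 ->
  0 < z <= 1 -> u z = 0 -> 0 < l.
Proof.
move=> su w0 /andP[z0 z1] uz; rewrite ltNge; apply/negP; rewrite le_eqVlt.
move=> /predU1P[l0|l0].
  case: su => _ /(_ z); rewrite l0 uz mul0r subr0 (ltW z0) z1 => /(_ isT)/esym/eqP.
  rewrite mulf_eq0 (negbTE w0)/= => /eqP Nz.
  by have := cell_cdf_lt hN (lexx 0) z0 z1; rewrite Nz N0 ltxx.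
have [y /andP[y0 yz] Ny] := sturm_comparison l0 su w0 scale_solution (lexx 0) z0 z1
  (string_solution0 su) uz.
have := cell_cdf_lt hN (lexx 0) y0; rewrite Ny N0 ltxx => h.
suff : false by []; apply: h; lra.
Qed.

(** Fermat's rule with respect to [N]: a nonzero slope makes [u - u z] change sign at [z]. *)
Lemma local_extremum_slope l w u z : string_solution l w u -> 0 < z < 1 ->
  local_extremum u z -> slope l w u z = 0.
Proof.
move=> su /andP[z0 z1] ext; apply/eqP/negPn/negP => s0.
have z01 : 0 <= z <= 1 by rewrite !ltW.
have [d d0 hd] := string_solution_near su z01 s0.
wlog ext' : u w su s0 hd {ext} / \forall y \near z, u y <= u z.
  case: ext => [e hw|e hw]; first exact: (hw u w).
  apply: (hw (fun x => - u x) (- w)); first exact: string_solutionN.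
  - by rewrite slopeN ?oppr_eq0//; case: su.
  - move=> x x01 xz; rewrite slopeN; last by case: su.
    rewrite [`|- slope _ _ _ _|]normrN -[leLHS]normrN; apply: le_trans (hd x x01 xz).
    by rewrite le_eqVlt; apply/orP; left; apply/eqP; congr `|_|; ring.
  - by move: e; apply: filterS => y; rewrite lerN2.
have /nbhs_ballP[e /= e0 he] := ext'.
pose r := Num.min (Num.min d (e / 2)) (Num.min (z / 2) ((1 - z) / 2)).
have r0 : 0 < r by rewrite !lt_min; apply/and3P; split; [rewrite d0| |]; lra.
have rd : r <= d by rewrite !ge_min lexx.
have re : r <= e / 2 by rewrite !ge_min lexx !orbT.
have rz : r <= z / 2 by rewrite !ge_min lexx !orbT.
have rz1 : r <= (1 - z) / 2 by rewrite !ge_min lexx !orbT.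
have hr x : x = z + r \/ x = z - r -> u x <= u z /\
  `|u x - u z - slope l w u z * (N x - N z)| <= `|slope l w u z| / 2 * `|N x - N z|.
  move=> xr; have xz : `|x - z| = r.
    by case: xr => ->; rewrite addrC addKr ?normrN gtr0_norm.
  split; first by apply: he; rewrite /ball/= distrC xz; lra.
  by apply: hd; [case: xr => ->; lra|rewrite xz].
have [u1 h1] := hr _ (or_introl erefl); have [u2 h2] := hr _ (or_intror erefl).
have N1' : N z < N (z + r) by apply: (cell_cdf_lt hN); lra.
have N2' : N (z - r) < N z by apply: (cell_cdf_lt hN); lra.
rewrite (gtr0_norm (_ : 0 < N (z + r) - N z)) ?subr_gt0// ler_norml in h1.
rewrite (ltr0_norm (_ : N (z - r) - N z < 0)) ?subr_lt0// ler_norml in h2.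
move: h1 h2 u1 u2 s0 N1' N2'; move: (slope _ _ _ _) (u _) (u _) (u _) (N _) (N _) (N _).
move=> s a1 a2 a3 b1 b2 b3 /andP[h1 h1'] /andP[h2 h2'] u1 u2 s0 n1 n2.
have [sp|sn] := ltrP 0 s.
  rewrite gtr0_norm// in h1 h1' h2 h2'; nra.
have {}sn : s < 0 by rewrite lt_neqAle s0.
rewrite ltr0_norm// in h1 h1' h2 h2'; nra.
Qed.

(** * Stability of zeros under a change of the parameter *)

Lemma picard_lim_le_all l x : `|picard_lim l x| <= expR `|l|.
Proof.
have -> : picard_lim l x = picard_lim l (clamp x).
  by rewrite /picard_lim [clamp (clamp x)]clamp_id// clamp_itv.
exact: picard_lim_le (clamp_itv x).
Qed.

Lemma scale_lower (h : R) : 0 < h -> h <= 1 -> exists2 k : R, 0 < k &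
  forall a b, 0 <= a -> b <= 1 -> h <= b - a -> k <= N b - N a.
Proof.
move=> h0 h1; have h10 : 0 <= 1 - h by lra.
have cN := cell_cdf_continuous hN.
have cf : continuous (fun x => N (x + h) - N x).
  move=> x; apply: cvgB; last exact: cN.
  apply: (@continuous_comp _ _ _ (fun y => y + h) N); last exact: cN.
  by apply: cvgD; [exact: cvg_id|exact: cvg_cst].
have [c + hc] := EVT_min h10 (continuous_subspaceT cf).
rewrite in_itv /= => /andP[c0 ch].
exists (N (c + h) - N c); first by rewrite subr_gt0; apply: (cell_cdf_lt hN); lra.
move=> a b a0 b1 hab; have := hc a; rewrite in_itv /= => /(_ ltac:(lra)).
have ahb : a + h <= b by lra.
by have := N_mono ahb; lra.
Qed.

(** Simplicity of zeros made uniform. The sum of the absolute values of solution and slope never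
    vanishes, so it has a positive minimum [m] on [0, 1]; this bounds the slopes at zeros for all
    nearby parameters and gives a window independent of the zero. *)
Lemma picard_lim_zero_near l : exists c r e : R, [/\ 0 < c, 0 < r, 0 < e &
  forall l' s, `|l' - l| <= e -> 0 <= s <= 1 -> picard_lim l' s = 0 ->
    c <= `|slope l' 1 (picard_lim l') s| /\
    forall x, 0 <= x <= 1 -> `|x - s| <= r ->
      `|picard_lim l' x - slope l' 1 (picard_lim l') s * (N x - N s)|
        <= `|slope l' 1 (picard_lim l') s| / 2 * `|N x - N s|].
Proof.
have cp := cb_picard_lim l; have cs := cb_slope l 1 cp.
have ch := cbD (cb_norm cp) (cb_norm cs).
have [z + hz] := EVT_min ler01 (continuous_subspaceT ch.1).
rewrite in_itv /= => z01; set m := `|_| + `|_| in hz.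
have m0 : 0 < m.
  rewrite /m; have [pz|pz] := eqVneq (picard_lim l z) 0; last first.
    by rewrite ltr_pwDl ?normr_gt0.
  by rewrite ltr_wpDl// normr_gt0; apply/eqP/picard_lim_simple.
(* An error [m / 4] is spent on the value and another on the slope, leaving a slope of at least
   [m / 2] at each zero. *)
have [d d0 hd] := picard_lim_continuous l (divr_gt0 m0 (ltr0Sn _ 3)).
pose L := `|l| + 1; have L0 : 0 < L by rewrite ltr_wpDl.
have LB : 0 < L * expR L by rewrite mulr_gt0// expR_gt0.
have m40 : 0 < m / 4 / (L * expR L) by rewrite !divr_gt0.
have [r r0 hr] := cell_cdf_unif hM m40.
exists (m / 2), r, (Num.min d 1); split => //; first lra.
  by rewrite lt_min d0 ltr01.
move=> l' s; rewrite le_min => /andP[l'd l'1] s01 ps.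
have l'L : `|l'| <= L by have := ler_normD (l' - l) l; rewrite subrK /L; lra.
have [h1 h2] := hd l' l'd s s01.
have ms : m / 2 <= `|slope l' 1 (picard_lim l') s|.
  have := hz s; rewrite in_itv /= => /(_ s01).
  rewrite ps sub0r normrN in h1.
  have := ler_normB (slope l' 1 (picard_lim l') s)
    (slope l' 1 (picard_lim l') s - slope l 1 (picard_lim l) s).
  by rewrite opprB addrC subrK; lra.
split => // x x01 xs.
have := string_solution_expansion (picard_lim_solution l') (picard_lim_le_all l') s01 x01.
rewrite ps subr0 => /le_trans; apply.
rewrite (_ : `|l'| * _ = `|l'| * expR `|l'| * `|M x - M s| * `|N x - N s|); last by ring.
rewrite ler_wpM2r//; apply: (@le_trans _ _ (m / 4)); last lra.
have : `|M x - M s| <= m / 4 / (L * expR L).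
  have [le|/ltW le] := leP s x.
    by rewrite ger0_norm ?subr_ge0 ?M_mono// hr//; rewrite ger0_norm ?subr_ge0 in xs.
  rewrite distrC ger0_norm ?subr_ge0 ?M_mono// hr//.
  by rewrite distrC ger0_norm ?subr_ge0 in xs.
rewrite ler_pdivlMr//; apply: le_trans; rewrite mulrC ler_wpM2l//.
by rewrite ler_pM// ?expR_ge0// ler_expR.
Qed.

(** Zeros neither merge nor disappear. Two zeros within [r] would contradict the expansion at the
    first; a sign change across [s] with a uniform margin survives the passage from [l1] to [l2]. *)
Lemma picard_lim_persistence l : exists2 r : R, 0 < r &
  (exists2 e : R, 0 < e & forall l' s t, `|l' - l| <= e -> 0 <= s -> s < t -> t <= 1 ->
    picard_lim l' s = 0 -> picard_lim l' t = 0 -> r < t - s) /\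
  forall h, 0 < h -> h <= r -> h <= 1 -> exists2 e : R, 0 < e & forall l1 l2 s,
    `|l1 - l| <= e -> `|l2 - l| <= e -> picard_lim l1 s = 0 -> h <= s <= 1 - h ->
    exists2 z, `|z - s| <= h & picard_lim l2 z = 0.
Proof.
have [c [r [e [c0 r0 e0 hl]]]] := picard_lim_zero_near l.
exists r => //; split.
  exists e => // l' s t l'e s0 st t1 ps pt; rewrite ltNge; apply/negP => tr.
  have s01 : 0 <= s <= 1 by rewrite s0; lra.
  have [cs hs] := hl l' s l'e s01 ps; have := hs t; rewrite pt sub0r normrN normrM.
  move=> /(_ ltac:(lra)); rewrite [`|t - s|]gtr0_norm ?subr_gt0// => /(_ tr).
  have Nst : N s < N t by apply: (cell_cdf_lt hN).
  rewrite ler_pM2r ?normr_gt0 ?subr_eq0 ?gt_eqF//; lra.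
move=> h h0 hr h1; have [k k0 hk] := scale_lower h0 h1.
(* At [s - h] and [s + h] the solution for [l1] has absolute value at least [c * k / 2]; going to
   [l2] by way of [l] costs at most twice [c * k / 8]. *)
have ck : 0 < c * k / 8 by rewrite divr_gt0// mulr_gt0.
have [d d0 hd] := picard_lim_continuous l ck.
exists (Num.min d e); first by rewrite lt_min d0.
move=> l1 l2 s; rewrite !le_min => /andP[l1d l1e] /andP[l2d l2e] ps /andP[s0 s1].
have s01 : 0 <= s <= 1 by lra.
have [cs hs] := hl l1 s l1e s01 ps; set sg := slope _ _ _ _ in cs hs.
have p01 : 0 <= s + h <= 1 by lra.
have m01 : 0 <= s - h <= 1 by lra.
have := hs _ p01; rewrite addrC addKr gtr0_norm// => /(_ hr).
have := hs _ m01; rewrite addrC addKr normrN gtr0_norm// => /(_ hr).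
have km : k <= N s - N (s - h).
  apply: hk; [by rewrite subr_ge0|by case/andP: s01|].
  by rewrite opprB addrC subrK.
have kp : k <= N (s + h) - N s.
  by apply: hk; [case/andP: s01|rewrite -lerBrDr|rewrite addrC addKr].
rewrite (ler0_norm (_ : N (s - h) - N s <= 0)); last first.
  by rewrite -oppr_ge0 opprB (le_trans (ltW k0)).
rewrite (ger0_norm (_ : 0 <= N (s + h) - N s)); last exact: le_trans (ltW k0) kp.
have [d1p _] := hd l1 l1d _ p01; have [d2p _] := hd l2 l2d _ p01.
have [d1m _] := hd l1 l1d _ m01; have [d2m _] := hd l2 l2d _ m01.
have sm : s - h <= s + h by rewrite lerD2l ge0_cp// ltW.
have := continuous_zero (cb_picard_lim l2).1 sm.
move=> hz h3 h4.
have [z zs pz] : exists2 z, s - h <= z <= s + h & picard_lim l2 z = 0.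
  exact/hz/(perturbed_sign_change c0 k0 km kp d1p d2p d1m d2m h3 h4 cs).
exists z => //; case/andP: zs => z1 z2; rewrite ler_norml lerBrDr lerBlDr.
by rewrite addrC z1 addrC z2.
Qed.

(** * Counting interior zeros and eigenvalues *)

Definition zeros_ge (n : nat) u : Prop := exists s : seq R,
  [/\ size s = n, path <%R 0 s & forall x, x \in s -> x < 1 /\ u x = 0].

Lemma path_lt_gt a (s : seq R) x : path <%R a s -> x \in s -> a < x.
Proof. by move=> /(order_path_min lt_trans)/allP; apply. Qed.

Lemma path_lt_le a b (s : seq R) : a <= b -> path <%R b s -> path <%R a s.
Proof. by case: s => //= x s ab /andP[bx ->]; rewrite (le_lt_trans ab bx). Qed.

(** Zeros move by at most [h] while gaps exceed [3 * h], so their order survives. The induction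
    keeps [a + h] as lower bound, the furthest place to which the preceding zero can have moved. *)
Lemma zeros_transfer h u v a (s : seq R) : 0 < h ->
  (forall x y, 0 <= x -> x < y -> y <= 1 -> u x = 0 -> u y = 0 -> 3 * h < y - x) ->
  (forall x, u x = 0 -> h <= x <= 1 - h -> exists2 z, `|z - x| <= h & v z = 0) ->
  0 <= a -> u a = 0 -> path <%R a s -> (forall x, x \in s -> x < 1 - h /\ u x = 0) ->
  exists t : seq R, [/\ size t = size s, path <%R (a + h) t &
    forall x, x \in t -> x < 1 /\ v x = 0].
Proof.
move=> h0 sep near; elim: s a => [|x s IH] a a0 ua; first by exists [::].
move=> /= /andP[ax xs] hs.
have [xh ux] := hs x (mem_head _ _).
have axh : 3 * h < x - a by apply: sep => //; lra.
have [z] := near x ux ltac:(lra); rewrite ler_norml => /andP[z1 z2] vz.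
have x0 : 0 <= x by lra.
have [t [st pt ht]] := IH x x0 ux xs (fun y ys => hs y (mem_behead (s := x :: s) ys)).
exists (z :: t); split; first by rewrite /= st.
  by rewrite /= (path_lt_le _ pt) ?andbT; lra.
by move=> y; rewrite inE => /predU1P[->|/ht//]; split => //; lra.
Qed.

Lemma interlacing l l' w w' u v a (s : seq R) : l < l' ->
  string_solution l w u -> w != 0 -> string_solution l' w' v ->
  0 <= a -> u a = 0 -> path <%R a s -> (forall x, x \in s -> x <= 1 /\ u x = 0) ->
  exists t : seq R, [/\ size t = size s, path <%R a t &
    forall x, x \in t -> x < last a s /\ v x = 0].
Proof.
move=> ll' su w0 sv; elim: s a => [|x s IH] a a0 ua; first by exists [::].
move=> /= /andP[ax xs] hs.
have [x1 ux] := hs x (mem_head _ _).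
have [z /andP[az zx] vz] := sturm_comparison ll' su w0 sv a0 ax x1 ua ux.
have [t [st pt ht]] := IH x (ltW (le_lt_trans a0 ax)) ux xs
  (fun y ys => hs y (mem_behead (s := x :: s) ys)).
exists (z :: t); split; first by rewrite /= st.
  by rewrite /= az (path_lt_le (ltW zx) pt).
move=> y; rewrite inE => /predU1P[->|/ht//]; split => //.
apply: (lt_le_trans zx); have := mem_last x s; rewrite inE => /predU1P[->//|].
by move=> /(path_lt_gt xs)/ltW.
Qed.

(** Together with 0 and 1, the [n] interior zeros bound [n.+1] gaps, and each gap receives a
    zero. *)
Lemma zeros_ge_next n l l' : l < l' -> picard_lim l 1 = 0 ->
  zeros_ge n (picard_lim l) -> zeros_ge n.+1 (picard_lim l').
Proof.
move=> ll' pl [s [sn ps hs]].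
have p1 : path <%R 0 (rcons s 1).
  rewrite rcons_path ps /=; have := mem_last 0 s; rewrite inE => /predU1P[->|/hs[]//].
  exact: ltr01.
have p2 x : x \in rcons s 1 -> x <= 1 /\ picard_lim l x = 0.
  by rewrite mem_rcons inE => /predU1P[->//|/hs[/ltW]].
have [t [st pt ht]] := interlacing ll' (picard_lim_solution l) (oner_neq0 _)
  (picard_lim_solution l') (lexx 0) (string_solution0 (picard_lim_solution l)) p1 p2.
exists t; split => //; first by rewrite st size_rcons sn.
by move=> x /ht; rewrite last_rcons.
Qed.

(* The infimum of the parameters whose solution has [n + 1] interior zeros is
   an eigenvalue: otherwise no zero could leave (0, 1) through 1 there, and by
   persistence of simple zeros the infimum would be attained and not minimal. *)
Lemma zeros_ge_eigenvalue n t : zeros_ge n.+1 (picard_lim t) ->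
  exists l, [/\ l < t, picard_lim l 1 = 0 & zeros_ge n (picard_lim l)].
Proof.
move=> tn; pose A := [set l | zeros_ge n.+1 (picard_lim l)].
have p0 l : picard_lim l 0 = 0 := string_solution0 (picard_lim_solution l).
(* A single zero in (0, 1) already forces the parameter to be positive. *)
have Alb : has_lbound A.
  exists 0 => l [[|x s] [//= _ /andP[x0 _] /(_ x (mem_head _ _))[x1 px]]].
  apply: ltW; apply: (string_solution_zero_gt0 (picard_lim_solution l) (oner_neq0 _) _ px).
  by rewrite x0 ltW.
have Ainf : has_inf A by split; [exists t|].
set m := inf A; have [r r0 [[e1 e10 sep] pers]] := picard_lim_persistence m.
have lower e : 0 < e -> exists2 l, A l & `|l - m| <= e.
  move=> e0; have [l Al lm] := inf_adherent e0 Ainf; exists l => //.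
  by rewrite ger0_norm; [rewrite -/m in lm; lra|rewrite subr_ge0; exact: ge_inf].
have transfer h l1 l2 e (s : seq R) : 0 < h -> 3 * h <= r -> h <= 1 -> e <= e1 ->
    (forall l1 l2 s, `|l1 - m| <= e -> `|l2 - m| <= e -> picard_lim l1 s = 0 ->
      h <= s <= 1 - h -> exists2 z, `|z - s| <= h & picard_lim l2 z = 0) ->
    `|l1 - m| <= e -> `|l2 - m| <= e -> path <%R 0 s ->
    (forall x, x \in s -> x < 1 - h /\ picard_lim l1 x = 0) ->
    zeros_ge (size s) (picard_lim l2).
  move=> h0 hr h1 ee1 he l1e l2e ps hs.
  have [q [qs pq hq]] := @zeros_transfer h (picard_lim l1) (picard_lim l2) 0 s h0
    (fun x y hx xy hy px py => le_lt_trans hr (sep l1 x y (le_trans l1e ee1) hx xy hy px py))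
    (fun x px hx => he l1 l2 x l1e l2e px hx) (lexx 0) (p0 l1) ps hs.
  by exists q; split => //; apply: path_lt_le pq; rewrite add0r ltW.
(* Otherwise the [n.+1] zeros of the solution for [m] would persist at a smaller parameter [m - d].
   The radius [h] is taken below half the distance from the last zero to 1, so that none is too
   close to the end. *)
have nAm : ~ A m.
  move=> [s [sn ps hs]].
  have l1 : last 0 s < 1.
    by have := mem_last 0 s; rewrite inE => /predU1P[->|/hs[]//]; exact: ltr01.
  have ls x : x \in s -> x <= last 0 s.
    move: ps; clear; elim: s 0 => //= y s IH a /andP[ay ys].
    rewrite inE => /predU1P[->|]; last exact: IH.
    by have := mem_last y s; rewrite inE => /predU1P[->//|/(path_lt_gt ys)/ltW].
  pose h := Num.min (r / 3) (Num.min 1 ((1 - last 0 s) / 2)).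
  have h0 : 0 < h by rewrite !lt_min; apply/and3P; split; lra.
  have hr : h <= r / 3 by rewrite !ge_min lexx.
  have h1 : h <= 1 by rewrite !ge_min lexx !orbT.
  have hl : h <= (1 - last 0 s) / 2 by rewrite !ge_min lexx !orbT.
  have [e e0 he] := pers h h0 ltac:(lra) h1.
  pose d := Num.min e e1; have d0 : 0 < d by rewrite lt_min e0.
  have de : d <= e by rewrite ge_min lexx.
  have de1 : d <= e1 by rewrite ge_min lexx orbT.
  have : A (m - d).
    rewrite /A /= -sn; apply: (transfer h m (m - d) d s h0 _ h1 de1) => //.
    - lra.
    - by move=> k1 k2 x k1d k2d; apply: he; exact: le_trans de.
    - by rewrite subrr normr0 ltW.
    - by rewrite addrC addKr normrN gtr0_norm.
    - by move=> x xs; have := ls x xs; have [_ ->] := hs x xs; split => //; lra.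
  by move=> /(ge_inf Alb); rewrite -/m; lra.
have mt : m < t.
  rewrite lt_neqAle; apply/andP; split; last exact: ge_inf.
  by apply/eqP => mt; apply: nAm; rewrite mt.
exists m; split => //.
(* If the solution for [m] is nonzero at 1, nearby solutions have no zero close to 1; all their
   [n.+1] zeros then transfer to [m], against [nAm]. *)
- apply/eqP/negPn/negP => pm1.
  have [d d0 hd] : exists2 d, 0 < d & forall x, 1 - d <= x -> x <= 1 ->
      `|picard_lim m 1| / 2 <= `|picard_lim m x|.
    have P0 : 0 < `|picard_lim m 1| / 2 by rewrite divr_gt0// normr_gt0.
    have /cvgrPdist_le/(_ _ P0)/nbhs_ballP[d /= d0 hd] := (cb_picard_lim m).1 1.
    exists (d / 2) => [|x dx x1]; first by rewrite divr_gt0.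
    have : `|picard_lim m 1 - picard_lim m x| <= `|picard_lim m 1| / 2.
      by apply: hd; rewrite /ball /= ger0_norm; lra.
    by have := ler_normD (picard_lim m 1 - picard_lim m x) (picard_lim m x); rewrite subrK; lra.
  pose h := Num.min (r / 3) (Num.min 1 (d / 2)).
  have h0 : 0 < h by rewrite !lt_min; apply/and3P; split; lra.
  have hr : h <= r / 3 by rewrite !ge_min lexx.
  have h1 : h <= 1 by rewrite !ge_min lexx !orbT.
  have hhd : h <= d / 2 by rewrite !ge_min lexx !orbT.
  have [e e0 he] := pers h h0 ltac:(lra) h1.
  (* At a zero of a nearby solution close to 1, the solution for [m] would be at most a quarter of
     its value at 1, but it is at least half of it there. *)
  have P0 : 0 < `|picard_lim m 1| / 4 by rewrite divr_gt0// normr_gt0.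
  have [e2 e20 he2] := picard_lim_continuous m P0.
  pose d' := Num.min e (Num.min e1 e2); have d'0 : 0 < d' by rewrite !lt_min e0 e10.
  have d'e : d' <= e by rewrite ge_min lexx.
  have d'e1 : d' <= e1 by rewrite !ge_min lexx orbT.
  have d'e2 : d' <= e2 by rewrite !ge_min lexx !orbT.
  have [l [s [sn ps hs]] lm] := lower d' d'0.
  apply: nAm; rewrite /A /= -sn; apply: (transfer h l m d' s h0 _ h1 d'e1) => //.
  + lra.
  + by move=> k1 k2 x k1d k2d; apply: he; exact: le_trans d'e.
  + by rewrite subrr normr0 ltW.
  + move=> x xs; have [x1 px] := hs x xs; split => //; rewrite ltNge; apply/negP => xh.
    have x0 : 0 < x := path_lt_gt ps xs.
    have dx : 1 - d <= x.
      by rewrite (le_trans _ xh)// lerB// (le_trans hhd)// ler_pdivrMr// ler_peMr ?ler1n// ltW.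
    have x01 : 0 <= x <= 1 by rewrite !ltW.
    have := hd x dx (ltW x1).
    have [+ _] := he2 l (le_trans lm d'e2) x x01; rewrite px sub0r normrN.
    by move=> /[swap]/le_trans/[apply]; rewrite leNgt ltr_pM2l ?normr_gt0// ltf_pV2 ?posrE// ltr_nat.
(* The last zero [y] may escape through 1 and is given up. The others lie more than [r], hence
   [3 * h], to the left of [y < 1], and persist. *)
- pose h := Num.min (r / 3) 1.
  have h0 : 0 < h by rewrite !lt_min; apply/andP; split; lra.
  have hr : h <= r / 3 by rewrite !ge_min lexx.
  have h1 : h <= 1 by rewrite !ge_min lexx !orbT.
  have [e e0 he] := pers h h0 ltac:(lra) h1.
  pose d' := Num.min e e1; have d'0 : 0 < d' by rewrite !lt_min e0 e10.
  have d'e : d' <= e by rewrite ge_min lexx.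
  have d'e1 : d' <= e1 by rewrite !ge_min lexx orbT.
  have [l [s [sn ps hs]] lm] := lower d' d'0.
  case/lastP: s => [//|s y] in sn ps hs *.
  rewrite size_rcons in sn; case: sn => sn; rewrite -sn.
  move: ps; rewrite rcons_path => /andP[ps sy].
  have [y1 py] : y < 1 /\ picard_lim l y = 0 by apply: hs; rewrite mem_rcons mem_head.
  apply: (transfer h l m d' s h0 _ h1 d'e1) => //.
  + lra.
  + by move=> k1 k2 x k1d k2d; apply: he; exact: le_trans d'e.
  + by rewrite subrr normr0 ltW.
  + move=> x xs; have x0 : 0 < x := path_lt_gt ps xs.
    have [x1 px] : x < 1 /\ picard_lim l x = 0 by apply: hs; rewrite mem_rcons inE xs orbT.
    split => //; have xy : x < y.
      apply: le_lt_trans sy; move: ps xs; clear; elim: s 0 => //= z s IH a /andP[az zs].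
      rewrite inE => /predU1P[->|]; last exact: IH.
      by have := mem_last z s; rewrite inE => /predU1P[->//|/(path_lt_gt zs)/ltW].
    have := sep l x y ltac:(lra) (ltW x0) xy (ltW y1) px py; lra.
Qed.

Lemma zeros_ge_eigenvalues n t : zeros_ge n (picard_lim t) ->
  exists e : seq R, [/\ size e = n, path >%R t e &
    forall l, l \in e -> picard_lim l 1 = 0].
Proof.
elim: n t => [|n IH] t; first by exists [::].
move=> /zeros_ge_eigenvalue[l [lt l1 /IH[e [en pe he]]]].
exists (l :: e); split; rewrite /= ?en ?lt//.
by move=> k; rewrite inE => /predU1P[->//|/he].
Qed.

(** Opposite bound to [zeros_ge_eigenvalues]: climbing from the smallest eigenvalue of the
    descending list, each one passed adds a zero. *)
Lemma eigenvalues_zeros_ge (e : seq R) t : path >%R t e ->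
  (forall l, l \in e -> picard_lim l 1 = 0) -> zeros_ge (size e) (picard_lim t).
Proof.
elim: e t => [|l e IH] t; first by exists [::].
move=> /= /andP[lt pe] he; apply: (zeros_ge_next lt (he l (mem_head _ _))).
by apply: IH => // k ke; apply: he; rewrite inE ke orbT.
Qed.

End StringEquation.

(** * The energy form and the weak formulation *)

Section Energy.
Context {R : realType} (p : R) (hp0 : 0 < p) (hp1 : p < 1).
Implicit Types (u v f : R -> R) (m k : nat).

Definition energy_bilinear m u v : R := \sum_(0 <= k < 4 ^ m) (resistance p m k)^-1
  * (u (k.+1%:R / 4 ^+ m) - u (k%:R / 4 ^+ m))
  * (v (k.+1%:R / 4 ^+ m) - v (k%:R / 4 ^+ m)).

Local Notation E := energy_bilinear.

Lemma energy_approxE m f : energy_approx p m f = E m f f.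
Proof. by apply: eq_bigr => k _; rewrite /resistance; ring. Qed.

Lemma sum_nat_mul4 (h : nat -> R) n : \sum_(0 <= k < 4 * n) h k =
  \sum_(0 <= k < n) (h (4 * k + 0)%N + h (4 * k + 1)%N + h (4 * k + 2)%N + h (4 * k + 3)%N).
Proof.
elim: n => [|n IH]; first by rewrite muln0 !big_nil.
have -> : (4 * n.+1 = (4 * n).+4)%N by lia.
rewrite !big_nat_recr//= IH addn0 addn1 addn2 addn3; ring.
Qed.

(** Resistors in series: forgetting the intermediate potential cannot raise the energy. The gap is
    an explicit square. *)
Lemma sedrakyan (a b s t : R) : 0 < s -> 0 < t ->
  (s + t)^-1 * (a + b) ^+ 2 <= s^-1 * a ^+ 2 + t^-1 * b ^+ 2.
Proof.
move=> s0 t0; rewrite -subr_ge0.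
have -> : s^-1 * a ^+ 2 + t^-1 * b ^+ 2 - (s + t)^-1 * (a + b) ^+ 2
    = (t * a - s * b) ^+ 2 / (s * t * (s + t)).
  by field; rewrite !gt_eqF// addr_gt0.
by rewrite divr_ge0 ?sqr_ge0// !mulr_ge0 ?addr_ge0// ltW.
Qed.

(** Three uses of [sedrakyan] merge the four children, whose resistances add up to that of the
    parent. *)
Lemma energy_refine m f : E m f f <= E m.+1 f f.
Proof.
rewrite /E expnS sum_nat_mul4; rewrite big_nat [leRHS]big_nat; apply: ler_sum => k /andP[_ km].
rewrite !resistance_split//.
have e4 : (4 : R) ^+ m != 0 by rewrite expf_neq0.
have -> : k%:R / 4 ^+ m = (4 * k + 0)%N%:R / 4 ^+ m.+1 :> R.
  by rewrite addn0 natrM exprS; field.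
have -> : k.+1%:R / 4 ^+ m = (4 * k + 3)%N.+1%:R / 4 ^+ m.+1 :> R.
  have -> : ((4 * k + 3).+1)%N = (4 * k.+1)%N by lia.
  by rewrite natrM exprS; field.
have -> : ((4 * k + 0).+1)%N = (4 * k + 1)%N by lia.
have -> : ((4 * k + 1).+1)%N = (4 * k + 2)%N by lia.
have -> : ((4 * k + 2).+1)%N = (4 * k + 3)%N by lia.
set y0 := f ((4 * k + 0)%N%:R / _); set y1 := f ((4 * k + 1)%N%:R / _).
set y2 := f ((4 * k + 2)%N%:R / _); set y3 := f ((4 * k + 3)%N%:R / _).
set y4 := f (_ / _); move: y0 y1 y2 y3 y4 => y0 y1 y2 y3 y4.
have r0 := resistance_gt0 hp0 hp1 m k; move: (resistance p m k) r0 => r r0.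
have c0 j : 0 < split_ratio p j.
  by rewrite /split_ratio; case: ifP => _; rewrite divr_gt0 ?subr_gt0.
have c1 : split_ratio p 0 + split_ratio p 1 + split_ratio p 2 + split_ratio p 3 = 1.
  by rewrite /split_ratio /=; field.
move: (c0 0%N) (c0 1%N) (c0 2%N) (c0 3%N) c1.
move: (split_ratio p 0) (split_ratio p 1) (split_ratio p 2) (split_ratio p 3).
move=> a b c d a0 b0 cc0 d0 s1.
have h1 := @sedrakyan (y1 - y0) (y2 - y1) (r * a) (r * b) (mulr_gt0 r0 a0) (mulr_gt0 r0 b0).
have ab0 : 0 < r * a + r * b by rewrite addr_gt0// mulr_gt0.
have h2 := @sedrakyan (y1 - y0 + (y2 - y1)) (y3 - y2) _ (r * c) ab0 (mulr_gt0 r0 cc0).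
have abc0 : 0 < r * a + r * b + r * c by rewrite addr_gt0// mulr_gt0.
have h3 := @sedrakyan (y1 - y0 + (y2 - y1) + (y3 - y2)) (y4 - y3) _ (r * d) abc0 (mulr_gt0 r0 d0).
have rE : r * a + r * b + r * c + r * d = r by rewrite -!mulrDr s1 mulr1.
rewrite rE in h3; move: h1 h2 h3.
have -> : y1 - y0 + (y2 - y1) + (y3 - y2) + (y4 - y3) = y4 - y0 by ring.
rewrite -!mulrA -!expr2; lra.
Qed.

Lemma energy_nondecreasing f : nondecreasing_seq (fun m => E m f f).
Proof. by apply/nondecreasing_seqP => m; exact: energy_refine. Qed.

Lemma energyE f : energy p f = limn (fun m => (E m f f)%:E).
Proof. by rewrite /energy; congr (limn _); apply/funext => m; rewrite energy_approxE. Qed.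

Lemma energy_bounded f (C : R) : (forall m, E m f f <= C) ->
  (energy p f < +oo)%E /\ (fun m => E m f f) @ \oo --> fine (energy p f).
Proof.
move=> fC; have cf : cvgn (fun m => E m f f).
  apply: nondecreasing_is_cvgn; first exact: energy_nondecreasing.
  by exists C => _ [m _ <-].
have -> : energy p f = (limn (fun m => E m f f))%:E by rewrite energyE EFin_lim.
by split; [exact: ltry|exact: cf].
Qed.

Lemma energy_finite f : (energy p f < +oo)%E -> exists C, forall m, E m f f <= C.
Proof.
rewrite energyE => fin.
have nd : nondecreasing_seq (fun m => (E m f f)%:E).
  by move=> m n mn; rewrite lee_fin; exact: energy_nondecreasing.
have lb m : ((E m f f)%:E <= limn (fun m => (E m f f)%:E))%E.
  rewrite (cvg_lim _ (ereal_nondecreasing_cvgn nd))//.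
  by apply: ereal_sup_ubound; exists m.
exists (fine (limn (fun m => (E m f f)%:E))) => m.
rewrite -lee_fin fineK// fin_numElt fin andbT.
by apply: lt_le_trans (lb 0%N); exact: ltNyr.
Qed.

(** [energy_form] passes through [fine], which is faithful only on finite energies; the
    parallelogram law at each level bounds those of the sum and the difference. *)
Lemma energy_form_cvg u v : (energy p u < +oo)%E -> (energy p v < +oo)%E ->
  (fun m => E m u v) @ \oo --> energy_form p u v.
Proof.
move=> /energy_finite[C uC] /energy_finite[D vD].
have paral m : E m (u \+ v) (u \+ v) + E m (u \- v) (u \- v) = 2 * E m u u + 2 * E m v v.
  rewrite /E !mulr_sumr -!big_split/=; apply: eq_bigr => k _; ring.
have polar m : E m u v = (E m (u \+ v) (u \+ v) - E m (u \- v) (u \- v)) / 4.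
  rewrite /E -sumrB mulr_suml; apply: eq_bigr => k _ /=.
  by move: (_^-1) => r; field.
have pos m f : 0 <= E m f f.
  rewrite sumr_ge0// => k _; rewrite -mulrA -expr2 mulr_ge0 ?sqr_ge0//.
  by rewrite invr_ge0 ltW// resistance_gt0.
have [_ cp] := @energy_bounded (u \+ v) (2 * C + 2 * D) (fun m => ltac:(
  have := paral m; have := pos m (u \- v); have := uC m; have := vD m; lra)).
have [_ cm] := @energy_bounded (u \- v) (2 * C + 2 * D) (fun m => ltac:(
  have := paral m; have := pos m (u \+ v); have := uC m; have := vD m; lra)).
under eq_fun do rewrite polar.
by apply: cvgM; [exact: cvgB|exact: cvg_cst].
Qed.

(** Each cell contributes at most [C ^+ 2] times its resistance, and the total resistance is 1. *)
Lemma energy_lipschitz f (C : R) : (forall a b, 0 <= a -> a <= b -> b <= 1 ->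
  `|f b - f a| <= C * (scale_fun p b - scale_fun p a)) -> (energy p f < +oo)%E.
Proof.
move=> fC; apply: (@energy_bounded f (C ^+ 2) _).1 => m.
rewrite -[leRHS]mulr1 -(resistance_sum_total p m) /resistance_sum mulr_sumr.
rewrite /E big_nat [leRHS]big_nat; apply: ler_sum => k /andP[_ km].
have r0 := resistance_gt0 hp0 hp1 m k.
have e0 : 0 < (4 : R) ^+ m by rewrite exprn_gt0.
have := fC (k%:R / 4 ^+ m) (k.+1%:R / 4 ^+ m).
rewrite scale_cell// divr_ge0 ?(ltW e0)// ler_pM2r ?invr_gt0// ler_nat leqnSn.
rewrite ler_pdivrMr// mul1r -natrX ler_nat km => /(_ isT isT isT).
set d := f _ - f _ => hd; rewrite -mulrA mulrC ler_pdivrMr//.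
rewrite -expr2 -[d ^+ 2]real_normK ?num_real// -mulrA -expr2 -exprMn.
by rewrite ler_pXn2r// nnegrE// (le_trans _ hd).
Qed.

End Energy.

(** * Equivalence of the weak formulation with the string equation *)

Section WeakFormulation.
Context {R : realType} (p : R) (hp0 : 0 < p) (hp1 : p < 1).
Context (mu : probability (measurableTypeR R) R) (hmu : self_similar_measure p mu).
Implicit Types (u v f : R -> R) (m k : nat).

Local Notation N := (scale_fun p).
Local Notation F := (primitive mu).
Local Notation M := (mass mu).
Local Notation E := (energy_bilinear p).

Let hN : cell_cdf N. Proof. exact: scale_cell_cdf. Qed.
Let hM : cell_cdf M. Proof. exact: mass_cell_cdf hmu. Qed.
Let mu01 : mu `[0, 1]%classic = 1%E. Proof. exact: self_similar_carrier hmu. Qed.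
Let cb_N : cb N. Proof. exact: cell_cdf_cb. Qed.

Lemma sum_cells (h : R -> R) m :
  \sum_(0 <= k < 4 ^ m) (h (k.+1%:R / 4 ^+ m) - h (k%:R / 4 ^+ m)) = h 1 - h 0.
Proof.
rewrite (@telescope_sumr _ 0 (4 ^ m) (fun k => h (k%:R / 4 ^+ m)))//.
by rewrite mul0r natrX divff// expf_neq0.
Qed.

Lemma cell_itv m k : (k < 4 ^ m)%N -> [/\ 0 <= k%:R / 4 ^+ m :> R,
  k%:R / 4 ^+ m <= k.+1%:R / 4 ^+ m :> R & k.+1%:R / 4 ^+ m <= 1 :> R].
Proof.
move=> km; have e0 : 0 < (4 : R) ^+ m by rewrite exprn_gt0.
split; first by rewrite divr_ge0// ltW.
  by rewrite ler_pM2r ?invr_gt0// ler_nat.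
by rewrite ler_pdivrMr// mul1r -natrX ler_nat.
Qed.

(** The Green function with pole [a]; pairing it with [u] in the energy gives
    [u a] exactly as soon as [a] is a vertex of the approximating graph. *)
Definition green_test (a x : R) : R := Num.min (N x) (N a) - N a * N x.

Lemma green_test_lipschitz a x y : x <= y ->
  `|green_test a y - green_test a x| <= 2 * (N y - N x).
Proof.
move=> xy; have Nxy : N x <= N y by case: hN => + _ _ _; apply.
have /andP[a0 a1] := cell_cdf_itv a hN; rewrite /green_test ler_norml /Num.min.
move: (N x) (N y) (N a) Nxy a0 a1 => r s t rs t0 t1.
have h : 0 <= t * (s - r) <= s - r.
  by rewrite mulr_ge0 ?subr_ge0//= ler_piMl// subr_ge0.
by case: ifPn => h1; case: ifPn => h2; rewrite -?leNgt in h1 h2; lra.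
Qed.

(** Divided by the resistance of a cell, the increment of the test function is [1 - N a] before the
    pole and [- N a] after it, so the energy is a combination of two telescoping sums. *)
Lemma energy_green_test u m0 k0 : (k0 <= 4 ^ m0)%N -> u 0 = 0 -> u 1 = 0 ->
  forall m, (m0 <= m)%N -> E m u (green_test (k0%:R / 4 ^+ m0)) = u (k0%:R / 4 ^+ m0).
Proof.
move=> km0 u0 u1 m /subnKC <-; set n := (m - m0)%N.
have km : (4 ^ n * k0 <= 4 ^ (m0 + n))%N by rewrite expnD mulnC leq_mul2r km0 orbT.
have -> : k0%:R / 4 ^+ m0 = (4 ^ n * k0)%N%:R / 4 ^+ (m0 + n) :> R.
  by rewrite natrM natrX exprD; field; rewrite !expf_neq0.
move: (m0 + n)%N (4 ^ n * k0)%N km => {m0 k0 km0 n} m K Km.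
set a := K%:R / 4 ^+ m; pose x k : R := k%:R / 4 ^+ m.
have Nx k : (k <= 4 ^ m)%N -> N (x k) = resistance_sum p m k by exact: scale_dyadic.
have -> : E m u (green_test a) =
    \sum_(0 <= k < 4 ^ m) (if (k < K)%N then u (x k.+1) - u (x k) else 0)
    - N a * \sum_(0 <= k < 4 ^ m) (u (x k.+1) - u (x k)).
  rewrite mulr_sumr -sumrB /E big_nat [RHS]big_nat; apply: eq_bigr => k /andP[_ km].
  have r0 := resistance_gt0 hp0 hp1 m k.
  rewrite /green_test -/(x k) -/(x k.+1) (Nx k.+1 km) (Nx k (ltnW km)).
  rewrite [X in Num.min _ X](Nx K Km) [X in _ * _ * (_ - (Num.min _ X - _))](Nx K Km).
  rewrite resistance_sumS; have [kK|Kk] := ltnP k K.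
    rewrite !min_l; last 2 first.
    - exact/resistance_sum_mono/ltnW.
    - by rewrite -resistance_sumS; exact: resistance_sum_mono.
    by field; rewrite gt_eqF.
  rewrite !min_r; last 2 first.
  - exact: resistance_sum_mono.
  - by rewrite -resistance_sumS; apply: resistance_sum_mono => //; exact: leqW.
  by field; rewrite gt_eqF.
rewrite /x sum_cells u0 u1 subrr mulr0 subr0.
rewrite (big_cat_nat (n := K))//= [X in _ + X]big_nat [X in _ + X]big1 ?addr0.
  rewrite big_nat (eq_bigr (fun k => u (x k.+1) - u (x k))); last first.
    by move=> k /andP[_ ->].
  rewrite -big_nat (@telescope_sumr _ 0 K (fun k => u (x k)))//.
  by rewrite /x mul0r u0 subr0.
by move=> k /andP[Kk _]; rewrite ltnNge Kk.
Qed.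

Lemma green_test0 a : 0 <= a -> green_test a 0 = 0.
Proof.
move=> a0; rewrite /green_test (scale0 hp0 hp1) mulr0 subr0 min_l//.
by have /andP[] := cell_cdf_itv a hN.
Qed.

Lemma green_test1 a : green_test a 1 = 0.
Proof.
rewrite /green_test (scale1 hp0 hp1) mulr1 min_r ?subrr//.
by have /andP[] := cell_cdf_itv a hN.
Qed.

Lemma cb_green_test a : cb (green_test a).
Proof.
split; first by apply: (dominated_continuous hN (C := 2)) => x y; exact: green_test_lipschitz.
exists 2 => x; have /andP[n0 n1] := cell_cdf_itv x hN; have /andP[a0 a1] := cell_cdf_itv a hN.
rewrite /green_test ler_norml /Num.min; move: (N x) (N a) n0 n1 a0 a1 => r t r0 r1 t0 t1.
have h : 0 <= t * r <= 1 by rewrite mulr_ge0//= mulr_ile1.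
by case: ifPn => h1; lra.
Qed.

Lemma dom_green_test a : dom_energy p (green_test a).
Proof.
split; first exact/continuous_subspaceT/(cb_green_test a).1.
by apply: (energy_lipschitz hp0 hp1 (C := 2)) => x y _ + _; exact: green_test_lipschitz.
Qed.

(** Splitting the integral of [U] times the minimum at [a] produces the Volterra kernel; the terms
    proportional to [N a] gather into the initial slope. *)
Lemma green_volterra (l a : R) U : cb U -> 0 <= a <= 1 ->
  l * F (fun y => U y * green_test a y) 1
    = l * (F U 1 - F (fun y => N y * U y) 1) * N a - l * volterra N mu U a.
Proof.
move=> cU /andP[a0 a1].
have cNU : cb (fun y => N y * U y) by exact: cbM.
have cg := cb_green_test a.
have cm : cb (fun y => Num.min (N y) (N a)).
  have := cbD cg (cbZ (N a) cb_N); congr cb; apply/funext => y.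
  by rewrite /green_test subrK.
have cUm : cb (fun y => U y * Num.min (N y) (N a)) by exact: cbM.
have Nmono : {homo N : x y / x <= y} by case: hN.
have -> : F (fun y => U y * green_test a y) 1 =
    F (fun y => U y * Num.min (N y) (N a)) 1 - N a * F (fun y => N y * U y) 1.
  rewrite -primitiveZ// -primitiveB//; last exact: cbZ.
  by congr Rintegral; apply/funext => y; rewrite /green_test; ring.
have h1 : F (fun y => U y * Num.min (N y) (N a)) a = F (fun y => N y * U y) a.
  apply: (primitive_eq hM mu01) => // y _ ya.
  by rewrite (min_l (Nmono _ _ ya)) mulrC.
have h2 : F (fun y => U y * Num.min (N y) (N a)) 1 - F (fun y => U y * Num.min (N y) (N a)) a
    = N a * F U 1 - N a * F U a.
  rewrite -!primitiveZ//; apply: (primitive_incr_eq mu01) => //; first exact: cbZ.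
  by move=> y /andP[ay _] _; rewrite (min_r (Nmono _ _ (ltW ay))) mulrC.
have -> : F (fun y => U y * Num.min (N y) (N a)) 1
    = F (fun y => N y * U y) a + N a * F U 1 - N a * F U a by rewrite -h1; lra.
by rewrite /volterra; ring.
Qed.

Lemma dyadic_dense_eq f g : cb f -> cb g ->
  (forall m k, (k <= 4 ^ m)%N -> f (k%:R / 4 ^+ m) = g (k%:R / 4 ^+ m)) ->
  forall x, 0 <= x <= 1 -> f x = g x.
Proof.
move=> cf cg fg x /andP[x0 x1]; apply/eqP/negPn/negP => fgx.
have [xe|xne] := eqVneq x 1.
  by have := fg 0%N 1%N isT; rewrite expr0 divr1 -xe => /eqP; exact/negP.
have x1' : x < 1 by rewrite lt_neqAle xne.
have d0 : 0 < `|f x - g x| by rewrite normr_gt0 subr_eq0.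
have /cvgrPdist_lt/(_ _ d0)/nbhs_ballP[r /= r0 hr] := (cbB cf cg).1 x.
pose y := Num.min 1 (x + r / 2).
have xy : x < y by rewrite lt_min x1' /=; lra.
have y1 : y <= 1 by rewrite ge_min lexx.
have yr : y <= x + r / 2 by rewrite ge_min lexx orbT.
have [m [k [km xk ky]]] := dyadic_between x0 xy y1.
have [_ kk _] := cell_itv km.
have := hr (k%:R / 4 ^+ m); rewrite /ball /= fg; last exact: ltnW.
rewrite subrr subr0 ltxx => h; suff : false by [].
by apply: h; rewrite distrC gtr0_norm; lra.
Qed.

Lemma eigenfunction_solution l u : dirichlet_eigenfunction p mu l u ->
  exists w U, [/\ string_solution N mu l w U, w != 0 &
    forall x, 0 <= x <= 1 -> U x = u x].
Proof.
move=> [[x0 x0I ux0] u0 u1 [[cu eu] _ weak]].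
pose U x := u (clamp x); have cU : cb U := cb_clamp cu.
have UE x : 0 <= x <= 1 -> U x = u x by move=> x01; rewrite /U clamp_id.
(* This is the initial slope dictated by [green_volterra]. The equation is first obtained at dyadic
   points, the admissible poles, and then extended by continuity. *)
pose w := l * (F U 1 - F (fun y => N y * U y) 1).
have cV : cb (fun x => w * N x - l * volterra N mu U x).
  by apply: cbB; apply: cbZ => //; exact: (cb_volterra hN hM mu01).
have UV := dyadic_dense_eq cU cV.
have sU : string_solution N mu l w U.
  split => //; apply: UV => m k km.
  have a01 : 0 <= (k%:R / 4 ^+ m : R) <= 1.
    have e0 : 0 < (4 : R) ^+ m by rewrite exprn_gt0.
    apply/andP; split; first by rewrite divr_ge0// ltW.
    by rewrite ler_pdivrMr// mul1r -natrX ler_nat.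
  set a : R := k%:R / 4 ^+ m in a01 *.
  rewrite UE// -green_volterra// primitive1//; last exact/cbM/cb_green_test.
  have := weak _ (dom_green_test a) (green_test0 (proj1 (andP a01))) (green_test1 a).
  have -> : energy_form p u (green_test a) = u a.
    have h := energy_form_cvg hp0 hp1 eu (dom_green_test a).2.
    apply: (cvg_unique _ h) => //; apply: cvg_near_cst.
    by exists m => // n /= mn; exact: energy_green_test.
  have -> : \int[mu]_(x in `[0, 1]) (- (l * u x) * green_test a x)
      = \int[mu]_(x in `[0, 1]) (- l * (U x * green_test a x)).
    apply: eq_Rintegral => y; rewrite inE /= in_itv /= => y01.
    by rewrite UE//; ring.
  rewrite RintegralZl//; first by move=> ->; ring.
  by apply: cb_integrable => //; apply: cbM => //; exact: cb_green_test.
exists w, U; split => //; apply/eqP => w0.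
rewrite in_itv /= in x0I; move: ux0; rewrite -UE//.
by rewrite (string_solution_unique hN hM mu01 sU x0I) w0 mul0r eqxx.
Qed.

Lemma string_solution_lipschitz l w u : string_solution N mu l w u ->
  exists C, forall a b, 0 <= a -> a <= b -> b <= 1 -> `|u b - u a| <= C * (N b - N a).
Proof.
move=> su; have [B B0 uB] := cb_ubound su.1.
have [S S0 sS] := cb_ubound (cb_slope hM mu01 l w su.1).
exists (S + `|l| * B) => a b a0 ab b1.
have a01 : 0 <= a <= 1 by rewrite a0 (le_trans ab).
have b01 : 0 <= b <= 1 by rewrite b1 (le_trans a0).
have Nab : 0 <= N b - N a by rewrite subr_ge0; case: hN => + _ _ _; apply.
have Mab : 0 <= M b - M a by rewrite subr_ge0; case: hM => + _ _ _; apply.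
have M1 : M b - M a <= 1.
  by have /andP[? ?] := cell_cdf_itv a hM; have /andP[? ?] := cell_cdf_itv b hM; lra.
have := string_solution_expansion hN hM mu01 su uB a01 b01.
rewrite (ger0_norm Nab) (ger0_norm Mab) => h1.
have h2 : `|slope mu l w u a * (N b - N a)| <= S * (N b - N a).
  by rewrite normrM (ger0_norm Nab) ler_wpM2r.
have h3 : `|l| * (B * (N b - N a) * (M b - M a)) <= `|l| * (B * (N b - N a)).
  by rewrite ler_wpM2l// ler_piMr// mulr_ge0.
have := ler_normD (u b - u a - slope mu l w u a * (N b - N a)) (slope mu l w u a * (N b - N a)).
by rewrite subrK; lra.
Qed.

(** As [v] vanishes at both ends, the increments of slope times [v] sum to 0 and may be subtracted
    from the energy; each cell is then compared with its share of the integral. *)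
Lemma energy_solution_cvg l w u v : string_solution N mu l w u -> cb v ->
  v 0 = 0 -> v 1 = 0 ->
  (fun m => E m u v) @ \oo --> l * F (fun y => u y * v y) 1.
Proof.
move=> su cv v0 v1; have cu := su.1; have [B B0 uB] := cb_ubound cu.
have cuv : cb (fun y => u y * v y) by exact: cbM.
have cs := cb_slope hM mu01 l w cu.
have M01 : M 1 - M 0 = 1 by case: hM => _ m0 m1 _; rewrite (m0 0 (lexx _)) (m1 1 (lexx _)) subr0.
apply/cvgrPdist_le => e e0.
have K0 : 0 < 2 * `|l| * B + 1 by rewrite ltr_wpDl// !mulr_ge0.
have [d d0 hd] := uniform_continuity cv (divr_gt0 e0 K0).
have [m0 hm0] := expr4V_cvg0 d0.
exists m0 => // m /= m0m.
have md : (4 ^+ m)^-1 < d :> R.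
  apply: le_lt_trans hm0; rewrite lef_pV2 ?posrE ?exprn_gt0//.
  by rewrite ler_weXn2l// ler1n.
set t := e / _ in hd; have t0 : 0 <= t by rewrite /t divr_ge0// ltW.
pose W x := slope mu l w u x * v x.
have W0 : W 1 - W 0 = 0 by rewrite /W v0 v1 !mulr0 subrr.
have FE : l * F (fun y => u y * v y) 1 = l * (F (fun y => u y * v y) 1 - F (fun y => u y * v y) 0).
  by rewrite (primitive0 hM)// subr0.
have EW : E m u v = E m u v - (W 1 - W 0) by rewrite W0 subr0.
rewrite distrC FE EW -(sum_cells W m).
rewrite -(sum_cells (F (fun y => u y * v y)) m) mulr_sumr /E -!sumrB.
rewrite big_nat (le_trans (ler_norm_sum _ _ _))//.
apply: (@le_trans _ _ (\sum_(0 <= k < 4 ^ m) (2 * `|l| * B * t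
    * (M (k.+1%:R / 4 ^+ m) - M (k%:R / 4 ^+ m))))); last first.
  rewrite -mulr_sumr sum_cells M01 mulr1 /t mulrCA ger_pMr// ler_pdivrMr// mul1r.
  by rewrite lerDl.
rewrite [leRHS]big_nat; apply: ler_sum => k /andP[_ km].
have [x0 xy y1] := cell_itv km.
have NE := scale_cell hp0 hp1 km; have r0 := resistance_gt0 hp0 hp1 m k.
have xyd : `|k%:R / 4 ^+ m - k.+1%:R / 4 ^+ m| < d.
  by rewrite -mulrBl -natr1 opprD addrA subrr sub0r mulN1r normrN ger0_norm// invr_ge0 exprn_ge0.
move: x0 xy y1 NE xyd r0; move: (k%:R / 4 ^+ m) (k.+1%:R / 4 ^+ m) (resistance p m k).
move=> x y r x0 xy y1 NE xyd r0.
have x01 : 0 <= x <= 1 by rewrite x0 (le_trans xy).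
have y01 : 0 <= y <= 1 by rewrite y1 (le_trans x0).
have Mxy : 0 <= M y - M x by rewrite subr_ge0; case: hM => + _ _ _; apply.
pose rm := N y * (F u y - F u x) - (F (fun z => N z * u z) y - F (fun z => N z * u z) x).
have hrm : `|rm| <= B * r * (M y - M x).
  have := volterra_remainder hN hM mu01 cu x01 y01 (fun z _ => uB z).
  by rewrite NE (gtr0_norm r0) (ger0_norm Mxy).
have du : u y - u x = slope mu l w u x * r - l * rm.
  by rewrite (string_solution_incr su x01 y01) NE.
have ds : slope mu l w u y = slope mu l w u x - l * (F u y - F u x) by rewrite /slope; ring.
have dv : `|v y - v x| <= t by rewrite distrC hd.
pose q := v y * (F u y - F u x) - (F (fun z => u z * v z) y - F (fun z => u z * v z) x).
have hq : `|q| <= B * t * (M y - M x).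
  have cz : cb (fun z => v y * u z) by exact: cbZ.
  have -> : q = F (fun z => v y * u z - u z * v z) y - F (fun z => v y * u z - u z * v z) x.
    by rewrite /q !primitiveB// !primitiveZ//; ring.
  apply: (primitive_bound mu01) => //; first exact: cbB.
  move=> z /andP[xz zy] z01; rewrite [v y * _]mulrC -mulrBr normrM ler_pM//.
  apply: hd => //; apply: le_lt_trans xyd.
  by rewrite [leRHS]distrC !ger0_norm ?subr_ge0// lerB// ltW.
rewrite du /W ds.
(* The cell error consists of [q], from freezing [v] at the right end, and of the second-order
   remainder of [u] paired with the increment of [v]. Each is at most [B * t] times the mass of the
   cell, whence the constant [2 * |l| * B]. *)
have -> : r^-1 * (slope mu l w u x * r - l * rm) * (v y - v x)
  - ((slope mu l w u x - l * (F u y - F u x)) * v y - slope mu l w u x * v x)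
  - l * (F (fun z => u z * v z) y - F (fun z => u z * v z) x)
  = l * q - l * (r^-1 * rm * (v y - v x)).
  by rewrite /q; field; rewrite gt_eqF.
have hp : `|r^-1 * rm * (v y - v x)| <= B * (M y - M x) * t.
  rewrite normrM ler_pM// normrM gtr0_norm ?invr_gt0//.
  by rewrite mulrC ler_pdivrMr// mulrAC.
move: hp; set X := r^-1 * rm * _ => hp.
rewrite (le_trans (ler_normB _ _))// (normrM l q) (normrM l X).
have h1 := ler_wpM2l (normr_ge0 l) hq; have h2 := ler_wpM2l (normr_ge0 l) hp.
rewrite (le_trans (lerD h1 h2))// le_eqVlt; apply/orP; left; apply/eqP; ring.
Qed.

Lemma picard_lim_eigenfunction l : picard_lim N mu l 1 = 0 ->
  dirichlet_eigenfunction p mu l (picard_lim N mu l).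
Proof.
move=> p1; have su := picard_lim_solution hN hM mu01 l.
set u := picard_lim N mu l in p1 su *; have [cu eu] := su.
have u0 : u 0 = 0 := string_solution0 hN hM su.
have cst01 : {within `[0, 1], continuous (fun x => - (l * u x))}.
  by apply: continuous_subspaceT; exact: (cbN (cbZ l cu)).1.
have eu_fin : (energy p u < +oo)%E.
  by have [C] := string_solution_lipschitz su; exact: energy_lipschitz.
split=> //.
  (* A solution vanishing on [0, 1] would turn its equation at 1 into [0 = N 1], while [N 1 = 1]. *)
  apply: contrapT => nz; have z x : 0 <= x <= 1 -> u x = 0.
    by move=> x01; apply/eqP/negPn/negP => ux; apply: nz; exists x => //; rewrite in_itv.
  have := eu 1; rewrite lexx ler01 => /(_ isT).
  have -> : volterra N mu u 1 = 0.
    apply/eqP; rewrite -normr_eq0 eq_le normr_ge0 andbT.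
    have := @volterra_le _ _ _ hN hM mu01 u (fun=> 0) 1 cu (cb_cst 0).
    rewrite lexx ler01 primitive_cst mul0r; apply=> // y y01.
    by rewrite z// normr0.
  rewrite p1 (scale1 hp0 hp1) mulr0 subr0 mulr1 => /esym/eqP.
  by rewrite oner_eq0.
split=> //; first by split => //; exact: continuous_subspaceT cu.1.
move=> v [cv ev] v0 v1.
have cV := cb_clamp cv; set V := fun x => v (clamp x) in cV.
have VE x : 0 <= x <= 1 -> V x = v x by move=> x01; rewrite /V clamp_id.
have h := energy_form_cvg hp0 hp1 eu_fin ev.
have VE0 : V 0 = 0 by rewrite VE// lexx ler01.
have VE1 : V 1 = 0 by rewrite VE// lexx ler01.
have h2 := energy_solution_cvg su cV VE0 VE1.
have EE : (fun m => E m u V) = (fun m => E m u v).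
  apply/funext => m; rewrite /E big_nat [RHS]big_nat; apply: eq_bigr => k /andP[_ km].
  have [x0 xy y1] := cell_itv km.
  by rewrite !VE ?x0 ?y1 ?(le_trans xy)// (le_trans x0).
rewrite EE in h2; rewrite (cvg_unique _ h h2)//.
have cuV : cb (fun y => u y * V y) by exact: cbM.
rewrite primitive1//.
have -> : \int[mu]_(x in `[0, 1]) (- (l * u x) * v x)
    = \int[mu]_(x in `[0, 1]) (- l * (u x * V x)).
  apply: eq_Rintegral => y; rewrite inE /= in_itv /= => y01.
  by rewrite VE//; ring.
by rewrite RintegralZl//; [ring|exact: cb_integrable].
Qed.

End WeakFormulation.

(** * Oscillation *)

Section UniqueExtremum.
Context {R : realType} (N : R -> R) (mu : probability (measurableTypeR R) R).
Hypotheses (hN : cell_cdf N) (hM : cell_cdf (mass mu))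
  (mu01 : mu `[0, 1]%classic = 1%E).
Implicit Types (u : R -> R) (l w x y z : R).

Lemma local_extremumN u z : local_extremum u z -> local_extremum (fun x => - u x) z.
Proof.
by case=> h; [right|left]; move: h; apply: filterS => y; rewrite lerN2.
Qed.

(** A maximum on [x, y] gives existence. Two extrema would be two zeros of the slope, which strictly
    decreases where [u] is positive because [l] is. *)
Lemma string_solution_extremum_positive l w u x y : string_solution N mu l w u ->
  0 < l -> 0 <= x -> x < y -> y <= 1 -> u x = 0 -> u y = 0 ->
  (forall z, x < z < y -> 0 < u z) -> exists! z, x < z < y /\ local_extremum u z.
Proof.
move=> su l0 x0 xy y1 ux uy u0; have cu := su.1.
have [c + hc] := EVT_max (ltW xy) (continuous_subspaceT cu.1).
rewrite in_itv /= => /andP[xc cy].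
have mxy : x < (x + y) / 2 < y by lra.
have uc : 0 < u c.
  apply: lt_le_trans (u0 _ mxy) _; apply: hc; rewrite in_itv /=; lra.
have cxy : x < c < y.
  rewrite !lt_neqAle xc cy !andbT; apply/andP; split.
    by apply/eqP => xc'; rewrite -xc' ux ltxx in uc.
  by apply/eqP => cy'; rewrite cy' uy ltxx in uc.
have ext z : x < z < y -> local_extremum u z -> slope mu l w u z = 0.
  move=> zxy; apply: (local_extremum_slope hN hM mu01 su); lra.
have lec : local_extremum u c.
  left; have : `]x, y[%classic c by rewrite /= in_itv.
  move=> /(@near_in_itvoo _ x y c); apply: filterS => t; rewrite in_itv /= => txy.
  by apply: hc; rewrite in_itv /=; lra.
have inj z1 z2 : z1 < z2 -> x < z1 < y -> x < z2 < y ->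
    slope mu l w u z1 = 0 -> slope mu l w u z2 = 0 -> False.
  move=> z12 z1xy z2xy s1 s2.
  have mz : 0 < u ((z1 + z2) / 2) by apply: u0; lra.
  have := @primitive_pos _ _ hM mu01 u z1 z2 ((z1 + z2) / 2) cu
    ltac:(lra) ltac:(lra) ltac:(lra) ltac:(lra).
  have p0 : forall z, z1 <= z <= z2 -> 0 <= u z by move=> z z12'; rewrite ltW// u0//; lra.
  move=> /(_ p0 mz); rewrite /slope in s1 s2.
  have : l * primitive mu u z1 = l * primitive mu u z2 by lra.
  by move=> /(mulfI (lt0r_neq0 l0)) ->; rewrite ltxx.
exists c; split => // z [zxy /(ext z zxy) sz]; have sc := ext c cxy lec.
by have [h|h|//] := ltgtP c z; exfalso; [exact: (inj c z)|exact: (inj z c)].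
Qed.

Lemma string_solution_extremum l w u x y : string_solution N mu l w u ->
  0 < l -> 0 <= x -> x < y -> y <= 1 -> u x = 0 -> u y = 0 ->
  (forall z, x < z < y -> u z != 0) -> exists! z, x < z < y /\ local_extremum u z.
Proof.
move=> su l0 x0 xy y1 ux uy u0.
have [up|un] := continuous_sign su.1.1 xy u0.
  exact: (string_solution_extremum_positive su).
have nux : - u x = 0 by rewrite ux oppr0.
have nuy : - u y = 0 by rewrite uy oppr0.
have [c [[cxy ec] uc]] := string_solution_extremum_positive
  (string_solutionN hN su) l0 x0 xy y1 nux nuy
  (fun z zxy => etrans (oppr_gt0 _) (un z zxy)).
exists c; split=> [|z [zxy ez]]; last first.
  by apply: uc; split => //; exact: local_extremumN.
split => //; move: (local_extremumN ec).
by congr (local_extremum _ c); apply/funext => z; rewrite opprK.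
Qed.

End UniqueExtremum.

Lemma local_extremum_eq (R : realType) (f g : R -> R) (a b z : R) : a < z < b ->
  (forall x, a < x < b -> f x = g x) -> local_extremum f z -> local_extremum g z.
Proof.
move=> zab fg; have nab : \forall y \near z, a < y < b.
  have : `]a, b[%classic z by rewrite /= in_itv.
  by move=> /(@near_in_itvoo _ a b z); apply: filterS => t; rewrite in_itv.
by case=> h; [left|right]; apply: filterS2 nab h => y yab; rewrite !fg.
Qed.

Lemma card_uniq_seq (T : choiceType) (s : seq T) :
  uniq s -> [set` s] #= `I_(size s).
Proof.
elim: s => [_|x s IH /= /andP[xs us]].
  by rewrite (_ : [set` [::]] = set0) ?card_eq0 ?II0// -subset0 => x.
apply/eq_cardSP; exists x; first by rewrite /= inE eqxx.
rewrite (_ : _ `\ x = [set` s]); first exact: IH.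
apply/seteqP; split => y /=; first by rewrite inE => -[/predU1P[//|]].
move=> ys; split; first by rewrite inE ys orbT.
by move=> yx; rewrite -yx ys in xs.
Qed.

Lemma card_eq_uniq_seq (T : choiceType) (A : set T) (n : nat) : A #= `I_n ->
  exists s : seq T, [/\ uniq s, size s = n & forall x, x \in s <-> A x].
Proof.
move=> An; have finA : finite_set A by apply/finite_setP; exists n.
exists (finmap.enum_fset (fset_set A)); split; first exact: finmap.fset_uniq.
  exact: card_fset_set.
by move=> x; rewrite in_fset_set// inE.
Qed.

Section Oscillation.
Context {R : realType} (p : R) (hp0 : 0 < p) (hp1 : p < 1).
Context (mu : probability (measurableTypeR R) R) (hmu : self_similar_measure p mu).

Let hN : cell_cdf (scale_fun p). Proof. exact: scale_cell_cdf. Qed.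
Let hM : cell_cdf (mass mu). Proof. exact: mass_cell_cdf hmu. Qed.
Let mu01 : mu `[0, 1]%classic = 1%E. Proof. exact: self_similar_carrier hmu. Qed.
Local Notation phi := (picard_lim (scale_fun p) mu).

Lemma dirichlet_eigenvalueE l : dirichlet_eigenvalue p mu l <-> phi l 1 = 0.
Proof.
split=> [[u eu]|p1]; last by exists (phi l); exact: picard_lim_eigenfunction.
have [w [U [sU w0 UE]]] := eigenfunction_solution hp0 hp1 hmu eu.
have [_ _ u1 _] := eu; have o1 : 0 <= (1 : R) <= 1 by rewrite ler01 lexx.
have := string_solution_unique hN hM mu01 sU o1; rewrite UE// u1 => /esym/eqP.
by rewrite mulf_eq0 (negbTE w0) => /eqP.
Qed.

Lemma eigenfunction_zero l u x : dirichlet_eigenfunction p mu l u -> 0 <= x <= 1 ->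
  u x = 0 <-> phi l x = 0.
Proof.
move=> /(eigenfunction_solution hp0 hp1 hmu)[w [U [sU w0 UE]]] x01.
rewrite -UE// (string_solution_unique hN hM mu01 sU x01).
split=> [/eqP|->]; last by rewrite mulr0.
by rewrite mulf_eq0 (negbTE w0) => /eqP.
Qed.

(** The [n] eigenvalues below [l] give [n] zeros; one zero more would give [n.+1] eigenvalues below
    [l], too many for the given cardinality. *)
Lemma zeros_count (n : nat) (l : R) :
  [set l' | dirichlet_eigenvalue p mu l' /\ l' < l] #= `I_n ->
  [set x : R | 0 < x < 1 /\ phi l x = 0] #= `I_n.
Proof.
move=> /card_eq_uniq_seq[e [ue se he]].
have [s [ss ps hs]] : zeros_ge n (phi l).
  have pe : path >%R l (rev (sort <=%R e)).
    rewrite path_sortedE; last by move=> x y z /[swap]; exact: lt_trans.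
    rewrite rev_sorted all_rev all_sort sort_lt_sorted ue andbT.
    by apply/allP => k /he[_].
  have := eigenvalues_zeros_ge hN hM mu01 pe; rewrite size_rev size_sort se; apply.
  by move=> k; rewrite mem_rev mem_sort => /he[/dirichlet_eigenvalueE].
have us : uniq s by apply: lt_sorted_uniq; exact: path_sorted ps.
suff -> : [set x : R | 0 < x < 1 /\ phi l x = 0] = [set` s] by rewrite -ss; exact: card_uniq_seq.
apply/seteqP; split => x /=; last first.
  by move=> xs; have [x1 px] := hs x xs; rewrite (path_lt_gt ps xs).
move=> [/andP[x0 x1] px]; apply: contrapT => /negP xs.
have [e' [se' pe' he']] : exists e : seq R, [/\ size e = n.+1, path >%R l e &
    forall l, l \in e -> phi l 1 = 0].
  apply: (zeros_ge_eigenvalues hN hM mu01); exists (sort <=%R (x :: s)); split.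
  - by rewrite size_sort /= ss.
  - rewrite path_sortedE; last exact: lt_trans.
    rewrite all_sort /= x0 sort_lt_sorted /= xs us !andbT.
    by apply/allP => y ys; exact: path_lt_gt ps ys.
  - by move=> y; rewrite mem_sort inE => /predU1P[->|/hs].
have : (size e' <= size e)%N.
  have gt_trans : transitive (>%R : rel R) by move=> a b c h1 h2; exact: lt_trans h2 h1.
  apply: uniq_leq_size.
    by apply: (@sorted_uniq _ (>%R : rel R)); [exact: gt_trans|exact: ltxx|exact: path_sorted pe'].
  move=> k ke; apply/he; split; first by apply/dirichlet_eigenvalueE/he'.
  by have /allP := order_path_min gt_trans pe'; apply.
by rewrite se' se ltnn.
Qed.

End Oscillation.

Theorem theorem5p2 (R : realType) (p : R) (hp0 : 0 < p) (hp1 : p < 1)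
    (mu : probability (measurableTypeR R) R)
    (hmu : self_similar_measure p mu) :
  [/\ (forall (l : R) (f : R -> R), dirichlet_eigenfunction p mu l f ->
        forall x y : R, consecutive_zeros f x y ->
          exists! z : R, x < z < y /\ local_extremum f z),
      (forall (i : nat) (li : R) (fi : R -> R),
        nth_dirichlet_eigenvalue p mu i li ->
        dirichlet_eigenfunction p mu li fi ->
        [set x : R | 0 < x < 1 /\ fi x = 0] #= `I_(i - 1)%N) &
      (forall (i j : nat) (li lj : R) (fi fj : R -> R),
        nth_dirichlet_eigenvalue p mu i li ->
        nth_dirichlet_eigenvalue p mu j lj ->
        dirichlet_eigenfunction p mu li fi ->
        dirichlet_eigenfunction p mu lj fj ->
        li < lj ->
        forall x y : R, consecutive_zeros fi x y ->
          exists z : R, x <= z <= y /\ fj z = 0)].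
Proof.
have hN := scale_cell_cdf hp0 hp1; have hM := mass_cell_cdf hp0 hp1 hmu.
have mu01 := self_similar_carrier hmu.
have sol l f := @eigenfunction_solution R p hp0 hp1 mu hmu l f.
split.
- move=> l f ef x y [[x0 xy y1] fx fy fz].
  have [w [U [sU w0 UE]]] := sol l f ef; have [_ _ f1 _] := ef.
  have l0 : 0 < l.
    apply: (string_solution_zero_gt0 hN hM mu01 sU w0 (z := 1)).
      by rewrite ltr01 lexx.
    by rewrite UE ?ler01 ?lexx.
  have UEo z : x < z < y -> U z = f z by move=> zxy; apply: UE; lra.
  have Ux : U x = 0 by rewrite UE//; lra.
  have Uy : U y = 0 by rewrite UE//; lra.
  have Uz z : x < z < y -> U z != 0 by move=> zxy; rewrite UEo// fz.
  have [z [[zxy ez] uz]] := string_solution_extremum hN hM mu01 sU l0 x0 xy y1 Ux Uy Uz.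
  (* [U] and [f] agree only on [0, 1]; being extremal is local, so agreement on (x, y) carries it
     over in both directions. *)
  exists z; split=> [|t [txy et]]; first by split => //; exact: (local_extremum_eq zxy UEo).
  apply: uz; split => //; apply: (local_extremum_eq txy _ et) => s sxy.
  by rewrite UEo.
- move=> i li fi [i1 _ /(zeros_count hp0 hp1 hmu) c] ei.
  congr (_ #= _): c; apply/seteqP; split => x /= [x01 h]; split => //;
    by apply/(eigenfunction_zero hp0 hp1 hmu ei); rewrite // !ltW; case/andP: x01.
- move=> i j li lj fi fj _ _ ei ej lij x y [[x0 xy y1] fx fy fz].
  have [w [U [sU w0 UE]]] := sol li fi ei.
  have [w' [V [sV _ VE]]] := sol lj fj ej.
  have Ux : U x = 0 by rewrite UE//; lra.
  have Uy : U y = 0 by rewrite UE//; lra.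
  have [z zxy Vz] := sturm_comparison hN hM mu01 lij sU w0 sV x0 xy y1 Ux Uy.
  exists z; split; first lra.
  by rewrite -VE//; lra.
Qed.
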